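(* Let $S$ be a finite set of states and $Y$ a set of prizes. (i) For every $Y$, every utility function $U:Y\to\mathbb{R}$ taking at least two different values, every $S$, and every weighted set $\mathcal{P}^+$ of probability measures on $S$, the family of MWER preference orders $\succeq^{S,Y,U}_{M,\mathcal{P}^+}$ (one per menu $M$) satisfies Axioms 1–10 listed in the context. (ii) Conversely, if a family of preference orders $\succeq_M$ (one per menu $M$) on the acts in $\Delta(Y)^S$ satisfies Axioms 1–10, then there exist a weighted set $\mathcal{P}^+$ of probability measures on $S$ and a utility function $U$ on $Y$ such that $\succeq_M\,=\,\succeq^{S,Y,U}_{M,\mathcal{P}^+}$ for every menu $M$. Moreover: - $U$ is unique up to affine transformations, i.e. up to replacing $U$ by $aU+b$ with constants $a>0$ and $b\in\mathbb{R}$. - $\mathcal{P}^+$ can be taken to be maximal, in the sense that if $\succeq_M\,=\,\succeq^{S,Y,U}_{M,(\mathcal{P}')^+}$ (for every menu $M$) for a weighted set $(\mathcal{P}')^+$, and $(\Pr,\alpha)\in(\mathcal{P}')^+$, then there exists $\alpha'\ge\alpha$ such that $(\Pr,\alpha')\in\mathcal{P}^+$.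
   Context: **Weighted sets.** A weighted set of probability measures on $S$ is a set $\mathcal{P}^+$ of pairs $(\Pr,\alpha)$ with $\Pr$ a probability measure on $S$ (all subsets measurable) and $\alpha\in[0,1]$. Put $\mathcal{P}=\{\Pr:\exists\alpha\,(\Pr,\alpha)\in\mathcal{P}^+\}$. For each $\Pr\in\mathcal{P}$ there is exactly one $\alpha$ with $(\Pr,\alpha)\in\mathcal{P}^+$; it is denoted $\alpha_{\Pr}$ and called the weight of $\Pr$. At least one $\Pr\in\mathcal{P}$ has $\alpha_{\Pr}=1$. **Acts.** $\Delta(Y)$ is the set of lotteries, i.e. finitely supported probability distributions on $Y$. An act is a function $f:S\to\Delta(Y)$. For acts $f,g$ and $p\in[0,1]$, $pf+(1-p)g$ is the act $s\mapsto pf(s)+(1-p)g(s)$. For $l\in\Delta(Y)$, $l^*$ is the constant act with value $l$. For a set $M$ of acts and an act $h$, $pM+(1-p)h=\{pf+(1-p)h: f\in M\}$. A utility $U:Y\to\mathbb{R}$ extends to lotteries by $u(l)=\sum_{y:\,l(y)>0}l(y)U(y)$. **Menus.** A menu is a set $M\subseteq\Delta(Y)^S$ of (feasible) acts. When a utility is given, it is assumed that every menu $M$ has utilities bounded from above, i.e. $\sup_{g\in M}u(g(s))$ is finite for every $s\in S$, so that regret is well defined. For an abstract family of preference orders, Axiom 10 below serves to enforce this assumption. **MWER.** For a menu $M$, $f\in M$ and $s\in S$, let $reg_M(f,s)=\sup_{g\in M}u(g(s))-u(f(s))$ and $$reg_{M,\mathcal{P}^+}(f)=\sup_{\Pr\in\mathcal{P}}\Big(\alpha_{\Pr}\sum_{s\in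 S}\Pr(s)\,reg_M(f,s)\Big).$$ Then $f\succeq^{S,Y,U}_{M,\mathcal{P}^+}g$ iff $reg_{M,\mathcal{P}^+}(f)\le reg_{M,\mathcal{P}^+}(g)$. (MWER stands for minimax weighted expected regret.) **Families.** A family of preference orders assigns to each menu $M$ a binary relation $\succeq_M$; writing $f\succeq_M g$ presupposes $f,g\in M$. As usual, $f\succ_M g$ means $f\succeq_M g$ and not $g\succeq_M f$; $f\sim_M g$ means $f\succeq_M g$ and $g\succeq_M f$; $\preceq$ is the reverse of $\succeq$. **Axioms**, universally quantified over acts $f,g,h$, menus $M,M'$, and $p\in(0,1)$: 1. (Transitivity) $f\succeq_M g\succeq_M h\Rightarrow f\succeq_M h$. 2. (Completeness) $f\succeq_M g$ or $g\succeq_M f$. 3. (Nontriviality) $f\succ_M g$ for some acts $f,g$ and some menu $M$. 4. (Monotonicity) If $(f(s))^*\succeq_{\{(f(s))^*,(g(s))^*\}}(g(s))^*$ for all $s\in S$, then $f\succeq_M g$. 5. (Mixture Continuity) If $f\succ_M g\succ_M h$, then there exist $q,r\in(0,1)$ such that $qf+(1-q)h\succ_{M\cup\{qf+(1-q)h\}}g$ and $g\succ_{M\cup\{rf+(1-r)h\}}rf+(1-r)h$. 6. (Ambiguity Aversion) $f\sim_M g\Rightarrow pf+(1-p)g\succeq_{M\cup\{pf+(1-p)g\}}g$. 7. (Independence) $f\succeq_M g$ iff $pf+(1-p)h\succeq_{pM+(1-p)h}pg+(1-p)h$. 8. (Menu independence for constant acts) If $l^*$ and $(l')^*$ are constant acts,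 then $l^*\succeq_M(l')^*$ iff $l^*\succeq_{M'}(l')^*$. (In light of this axiom, the menu is omitted when comparing constant acts.) 9. (Independence of Never Strictly Optimal Alternatives) If every act in $M'$ is never strictly optimal relative to $M$, then $f\succeq_M g$ iff $f\succeq_{M\cup M'}g$. Here an act $h$ is never strictly optimal relative to $M$ if for all $s\in S$ there is some $f\in M$ with $(f(s))^*\succeq(h(s))^*$. 10. (Boundedness of menus) For every menu $M$ there exists a lottery $\bar l\in\Delta(Y)$ such that $(f(s))^*\preceq\bar l^*$ for all $f\in M$ and $s\in S$.
   Formalization: False as stated; repaired: in (i) Axiom 10 is claimed only for menus bounded above by some lottery's utility (Axioms 1–9 for all bounded menus); in (ii) representation, uniqueness, maximality are over menus whose order is unchanged by adding acts that keep the statewise suprema. *)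

(* Defs.v *)
From HB Require Import structures.
From mathcomp Require Import all_boot all_order all_algebra.
From mathcomp Require Import finmap.
From mathcomp Require Import all_classical all_reals.
From mathcomp Require Import interval_inference convex.
Set Implicit Arguments.
Unset Strict Implicit.
Unset Printing Implicit Defensive.
Import Order.TTheory GRing.Theory Num.Theory.
Local Open Scope classical_set_scope.
Local Open Scope ring_scope.
Local Open Scope convex_scope.

Definition is_lottery (R : realType) (Y : choiceType)
    (l : {fsfun Y -> R with 0}) : bool :=
  all (fun y => 0 <= l y) (finsupp l) && (\sum_(y <- finsupp l) l y == 1).

Record lottery (R : realType) (Y : choiceType) := Lottery {
  mass :> {fsfun Y -> R with 0};
  _ : is_lottery mass }.

HB.instance Definition _ (R : realType) (Y : choiceType) :=
  [isSub for @mass R Y].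
HB.instance Definition _ (R : realType) (Y : choiceType) :=
  [Choice of lottery R Y by <:].

Section Mixture.
Context {R : realType} {Y : choiceType}.
Implicit Types (p : {i01 R}) (l : lottery R Y).

Lemma lottery_ge0 l y : 0 <= l y.
Proof.
case: (finsuppP l y) => // ly.
by case: l ly => f /= /andP[/allP f0 _] /f0.
Qed.

Lemma lottery_sum l : \sum_(y <- finsupp l) l y = 1.
Proof. by case: l => f /= /andP[_ /eqP]. Qed.

Lemma sum_finsupp (A : {fset Y}) (f : {fsfun Y -> R with 0}) :
  (finsupp f `<=` A)%fset -> \sum_(y <- A) f y = \sum_(y <- finsupp f) f y.
Proof.
move=> fA; apply/esym/big_fset_incl => // y _.
by case: finsuppP.
Qed.

Definition mix_mass p l l' : {fsfun Y -> R with 0} :=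
  [fsfun y in (finsupp l `|` finsupp l')%fset =>
     p%:num * l y + (1 - p%:num) * l' y].

Lemma mix_massE p l l' y :
  mix_mass p l l' y = p%:num * l y + (1 - p%:num) * l' y.
Proof.
rewrite fsfunE in_fsetU; case: ifPn => //; rewrite negb_or => /andP[ly l'y].
by rewrite !fsfun_dflt// !mulr0 addr0.
Qed.

Lemma mix_subproof p l l' : is_lottery (mix_mass p l l').
Proof.
have p0 : 0 <= p%:num :> R by [].
have p1 : 0 <= 1 - p%:num :> R by rewrite subr_ge0.
apply/andP; split.
  apply/allP => y _; rewrite mix_massE.
  by rewrite addr_ge0// mulr_ge0// lottery_ge0.
rewrite -(@sum_finsupp (finsupp l `|` finsupp l')%fset); last first.
  by apply/fsubsetP => y; apply: contraLR; rewrite memNfinsupp fsfunE => /negbTE ->.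
under eq_bigr do rewrite mix_massE.
rewrite big_split/= -!mulr_sumr !sum_finsupp ?fsubsetUl ?fsubsetUr//.
by rewrite !lottery_sum !mulr1 addrCA subrr addr0.
Qed.

Definition mix p l l' : lottery R Y := Lottery (mix_subproof p l l').

Lemma mixE p l l' y : mix p l l' y = p%:num * l y + (1 - p%:num) * l' y.
Proof. exact: mix_massE. Qed.

Lemma lotteryP l l' : (forall y, l y = l' y) -> l = l'.
Proof. by move=> ll'; apply/val_inj/fsfunP. Qed.

Let mix1 l l' : mix 1%:i01 l l' = l.
Proof. by apply: lotteryP => y; rewrite mixE/= subrr mul0r addr0 mul1r. Qed.

Let mixmm p l : mix p l l = l.
Proof. by apply: lotteryP => y; rewrite mixE -mulrDl addrCA subrr addr0 mul1r. Qed.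

Let mixC p l l' : mix p l l' = mix (1 - p%:inum)%:i01 l' l.
Proof. by apply: lotteryP => y; rewrite !mixE/= subKr addrC. Qed.

Let mixA : convex_quasi_associative mix.
Proof.
move=> p q r s a b c prs spq; apply: lotteryP => y; rewrite !mixE.
rewrite !mulrDr !mulrA addrA [s%:num * r%:num]mulrC -prs.
congr (_ + _ + _); first by congr (_ * _); exact: ConvexQuasiAssoc.pq_sr.
by congr (_ * _); exact: esym spq.
Qed.

HB.instance Definition _ :=
  isConvexSpace.Build R (lottery R Y) mix1 mixmm mixC mixA.

End Mixture.

Definition act (R : realType) (S : finType) (Y : choiceType) : Type :=
  S -> lottery R Y.

Section Acts.
Context {R : realType} {S : finType} {Y : choiceType}.
Local Notation act := (act R S Y).
Implicit Types (p : {i01 R}) (l : lottery R Y) (f g h : act) (M : set act).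

Definition const_act l : act := fun=> l.

Definition mix_act p f g : act := fun s => f s <| p |> g s.

Definition mix_menu p M h : set act := [set mix_act p f h | f in M].

(* The axioms compare acts relative to the menus M `|` [set pf+(1-p)g],
   pM+(1-p)h, {l*, l'*} and M `|` M'.  A menu system is a collection of sets
   of acts in which these are again menus; e.g. all sets of acts, the finite
   ones, or those on which a given utility is bounded above. *)
Record menu_system (menus : set (set act)) : Prop := MenuSystem {
  menu_set1 : forall f, menus [set f];
  menu_setU : forall M M', menus M -> menus M' -> menus (M `|` M');
  menu_mix : forall p M h, 0 < p%:num < 1 -> menus M -> menus (mix_menu p M h)
}.

Section PreferenceFamily.
(* [pref M f g] is only meaningful if M is a menu and f, g belong to M. *)
Variables (menus : set (set act)) (pref : set act -> act -> act -> Prop).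

Definition strict M f g := pref M f g /\ ~ pref M g f.

Definition indiff M f g := pref M f g /\ pref M g f.

(* Constant acts are compared in the menu that consists of just the two. *)
Definition const_pref l l' :=
  pref [set const_act l; const_act l'] (const_act l) (const_act l').

Definition never_strictly_optimal M h :=
  forall s, exists2 f, M f & const_pref (f s) (h s).

Record axioms1_9 : Prop := {
  transitivity : forall M f g h, menus M -> M f -> M g -> M h ->
    pref M f g -> pref M g h -> pref M f h;
  completeness : forall M f g, menus M -> M f -> M g ->
    pref M f g \/ pref M g f;
  nontriviality : exists M f g, [/\ menus M, M f, M g & strict M f g];
  monotonicity : forall M f g, menus M -> M f -> M g ->
    (forall s, const_pref (f s) (g s)) -> pref M f g;
  mixture_continuity : forall M f g h, menus M -> M f -> M g -> M h ->
    strict M f g -> strict M g h ->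
    exists q r : {i01 R}, [/\ 0 < q%:num < 1, 0 < r%:num < 1,
      strict (M `|` [set mix_act q f h]) (mix_act q f h) g &
      strict (M `|` [set mix_act r f h]) g (mix_act r f h)];
  ambiguity_aversion : forall M f g p, menus M -> M f -> M g ->
    0 < p%:num < 1 -> indiff M f g ->
    pref (M `|` [set mix_act p f g]) (mix_act p f g) g;
  independence : forall M f g h p, menus M -> M f -> M g ->
    0 < p%:num < 1 ->
    (pref M f g <-> pref (mix_menu p M h) (mix_act p f h) (mix_act p g h));
  menu_independence : forall M M' l l', menus M -> menus M' ->
    M (const_act l) -> M (const_act l') ->
    M' (const_act l) -> M' (const_act l') ->
    (pref M (const_act l) (const_act l') <->
     pref M' (const_act l) (const_act l'));
  never_strictly_optimal_independence : forall M M' f g,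
    menus M -> menus M' -> M f -> M g ->
    (forall h, M' h -> never_strictly_optimal M h) ->
    (pref M f g <-> pref (M `|` M') f g)
}.

Definition axiom10 : Prop := forall M, menus M ->
  exists lbar, forall f s, M f -> const_pref lbar (f s).

(* In every state, every lottery that is an upper bound of the outcomes of M
   is at least as good as the outcome of h: h does not exceed the statewise
   suprema of M, whether or not these are attained in M. *)
Definition below_suprema M h :=
  forall s l, (forall f, M f -> const_pref l (f s)) -> const_pref l (h s).

(* The order relative to M is not affected by acts that leave the statewise
   suprema unchanged.  An order defined from regret has this property since
   regret depends on M only through these suprema.  It follows from the axioms
   if the suprema are attained ([attained_sup_determined]), e.g. if M is
   finite, but not in general: two MWER rules for the same U, one on the menus that
   attain all their suprema and one on the others, jointly satisfy all the
   axioms. *)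
Definition sup_determined M := forall M', menus M' ->
  (forall h, M' h -> below_suprema M h) ->
  forall f g, M f -> M g -> (pref M f g <-> pref (M `|` M') f g).

Lemma attained_sup_determined M : axioms1_9 -> menus M ->
  (forall s, exists2 f, M f & forall g, M g -> const_pref (f s) (g s)) ->
  sup_determined M.
Proof.
move=> ax mM Mmax M' mM' M'M f g Mf Mg.
apply: (never_strictly_optimal_independence ax) => // h M'h s.
by have [k Mk kmax] := Mmax s; exists k => //; apply: M'M.
Qed.

End PreferenceFamily.

Section Regret.
Variable U : Y -> R.

Definition utility l : R := \sum_(y <- finsupp l) l y * U y.

Definition menu_utilities M (s : S) : set R := [set utility (g s) | g in M].

Definition utility_bounded M : Prop :=
  forall s, has_ubound (menu_utilities M s).

(* This differs from [utility_bounded] only if U is bounded above and does not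
   attain its supremum; then the set of all constant acts has bounded
   utilities, but it violates [axiom10]. *)
Definition lottery_bounded M : Prop :=
  exists lbar, forall f s, M f -> utility (f s) <= utility lbar.

Definition state_regret M f (s : S) : R :=
  sup (menu_utilities M s) - utility (f s).

(* As S is finite, [lottery R S] is the type of all probability measures on S. *)
Definition weighted_set (P : set (lottery R S * R)) : Prop :=
  [/\ forall Pr alpha, P (Pr, alpha) -> 0 <= alpha <= 1,
      forall Pr alpha alpha', P (Pr, alpha) -> P (Pr, alpha') -> alpha = alpha'
    & exists Pr, P (Pr, 1)].

Definition weighted_regret (P : set (lottery R S * R)) M f : R :=
  sup [set Pa.2 * \sum_(s : S) Pa.1 s * state_regret M f s | Pa in P].

Definition mwer (P : set (lottery R S * R)) M f g : Prop :=
  weighted_regret P M f <= weighted_regret P M g.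

(* The boundedness makes the real-valued [sup]s in [mwer] genuine suprema. *)
Definition represents (menus : set (set act))
    (pref : set act -> act -> act -> Prop) (P : set (lottery R S * R)) : Prop :=
  forall M, menus M -> utility_bounded M /\
    forall f g, M f -> M g -> (pref M f g <-> mwer P M f g).

End Regret.
End Acts.

(* Main.v *)
(* Soundness only uses that [reg |-> sup alpha E_Pr reg] is a monotone sublinear
   functional on nonnegative vectors that maps each constant to itself.

   For the converse, the constant acts satisfy the von Neumann-Morgenstern
   axioms, which gives U.  A menu determined by its suprema may be enlarged by
   an act k that attains all of them and then cut down to k and the two acts to
   be compared; mixing with an act that offsets U(k) makes the dominating act
   constant.  Hence the preference between f and g in M depends only on their
   two regret vectors, up to a common positive factor.  Assigning to a regret
   vector the constant vector indifferent to it gives a functional Phi that is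
   monotone, homogeneous (independence) and subadditive (ambiguity aversion).
   By Hahn-Banach Phi is the supremum of the functionals [alpha E_Pr] below it,
   and giving each Pr the largest such alpha yields the maximal weighted set. *)

Require Import Defs.
From mathcomp Require Import all_boot all_order all_algebra.
From mathcomp Require Import finmap.
From mathcomp Require Import all_classical all_reals.
From mathcomp Require Import interval_inference convex.
From mathcomp Require Import ring lra.
Set Implicit Arguments.
Unset Strict Implicit.
Unset Printing Implicit Defensive.
Import Order.TTheory GRing.Theory Num.Theory.
Local Open Scope classical_set_scope.
Local Open Scope ring_scope.
Local Open Scope convex_scope.

(** * Regret functionals *)

(** Two obstacles shape the converse. Utility may be bounded, so a prescribed regret vector need not
    be realised by acts: only the segment between two lotteries of utility 1 and -1 is at hand.
    Hence comparisons are shrunk into the unit box, where the zero-loss act dominates, and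
    independence makes the factor irrelevant. The same shrinking gives lotteries outside the segment
    their utility. Moreover ambiguity aversion speaks only of indifferent acts, so subadditivity is
    obtained by normalising two vectors to [Phi] equal to 1; the zeros of [Phi] then need a
    perturbation.

    Boundedness of menus does more than make suprema finite: it encloses each statewise supremum
    between the utilities of two lotteries, so that some lottery attains it. The weights are at most
    1 because [Phi] is 1 at the constant 1, and a measure supporting [Phi] there gets weight 1.
    Maximality needs no direct comparison of weighted sets: any representing set has supremum
    functional [Phi], since both functionals fix constants and induce the same order. *)

Lemma lottery_exists (R : realType) (Y : choiceType) (A : {fset Y}) (c : Y -> R) :
  (forall y, y \in A -> 0 <= c y) -> \sum_(y <- A) c y = 1 ->
  exists l : lottery R Y, forall y, l y = if y \in A then c y else 0.
Proof.
move=> c0 c1; pose m : {fsfun Y -> R with 0} := [fsfun y in A => c y].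
have mE y : m y = if y \in A then c y else 0 by rewrite fsfunE.
have lm : is_lottery m.
  apply/andP; split.
    by apply/allP => y _; rewrite mE; case: ifPn => // /c0.
  rewrite -(@sum_finsupp R Y A).
    by rewrite -c1; apply/eqP; apply: eq_big_seq => y yA; rewrite mE yA.
  by apply/fsubsetP => y; rewrite mem_finsupp mE; case: ifPn => // _ /eqP.
by exists (Lottery lm).
Qed.

Lemma sum_fset_finType (V : nmodType) (S : finType) (A : {fset S}) (F : S -> V) :
  (forall s, s \notin A -> F s = 0) -> \sum_(s <- A) F s = \sum_s F s.
Proof.
move=> F0; rewrite big_uniq ?fset_uniq//= [RHS](bigID (mem A))/=.
by rewrite [X in _ = _ + X]big1 ?addr0.
Qed.

Lemma lottery_fin_sum (R : realType) (S : finType) (l : lottery R S) :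
  \sum_s l s = 1.
Proof.
rewrite -(lottery_sum l); apply/esym/sum_fset_finType => s.
by rewrite memNfinsupp => /eqP.
Qed.

Lemma fin_lottery_exists (R : realType) (S : finType) (c : S -> R) :
  (forall s, 0 <= c s) -> \sum_s c s = 1 ->
  exists l : lottery R S, forall s, l s = c s.
Proof.
move=> c0 c1; pose A : {fset S} := [fset s in enum S]%fset.
have AE s : s \in A by rewrite /A !inE mem_enum.
have [||l lE] := @lottery_exists R S A c => //.
  by rewrite sum_fset_finType// => s; rewrite AE.
by exists l => s; rewrite lE AE.
Qed.

Section RegretFunctional.
Context {R : realType} {S : finType}.
Implicit Types (x y z : S -> R) (Phi : (S -> R) -> R).

Definition nonneg x := forall s, 0 <= x s.

(* Pointwise hypotheses instead of sums and multiples of functions, so that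
   the fields apply to vectors that are only extensionally of that form. *)
Record regret_functional Phi : Prop := {
  rf_mono : forall x y, nonneg x -> (forall s, x s <= y s) -> Phi x <= Phi y;
  rf_scale : forall c x y, 0 <= c -> nonneg x -> (forall s, y s = c * x s) ->
    Phi y = c * Phi x;
  rf_subadd : forall x y z, nonneg x -> nonneg y -> nonneg z ->
    (forall s, z s <= x s + y s) -> Phi z <= Phi x + Phi y;
  rf_cst : forall c, 0 <= c -> Phi (fun=> c) = c
}.

Section Theory.
Variable Phi : (S -> R) -> R.
Hypothesis rPhi : regret_functional Phi.

Lemma rf_ge0 x : nonneg x -> 0 <= Phi x.
Proof.
by move=> x0; rewrite -[leLHS](rf_cst rPhi (lexx 0)); apply: (rf_mono rPhi).
Qed.

Lemma rf_convex p x y z : 0 <= p <= 1 -> nonneg x -> nonneg y -> nonneg z ->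
  (forall s, z s <= p * x s + (1 - p) * y s) ->
  Phi z <= p * Phi x + (1 - p) * Phi y.
Proof.
move=> /andP[p0 p1] x0 y0 z0 zle.
have q0 : 0 <= 1 - p by rewrite subr_ge0.
rewrite -(@rf_scale _ rPhi p x (fun s => p * x s))//.
rewrite -(@rf_scale _ rPhi (1 - p) y (fun s => (1 - p) * y s))//.
by apply: (rf_subadd rPhi) => // s; rewrite mulr_ge0.
Qed.

Lemma fin_bound x : exists2 B, 0 < B & forall s, x s <= B.
Proof.
(* The summand 1 makes the bound positive even for the zero vector, so that one may divide by it. *)
exists (1 + \sum_s `|x s|).
  by rewrite ltr_pwDl// sumr_ge0.
move=> s; rewrite (bigD1 s)//= (le_trans (ler_norm _))//.
by rewrite addrCA lerDl addr_ge0// sumr_ge0.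
Qed.

(** If B bounds x, then d is at least (d/B) x, so y dominates (1 + d/B) x and homogeneity gives a
    strict gain. This is void when [Phi x] is 0; there y dominates the constant d. *)
Lemma rf_strict d x y : 0 < d -> nonneg x -> (forall s, x s + d <= y s) ->
  Phi x < Phi y.
Proof.
move=> d0 x0 xy; have [B B0 xB] := fin_bound x.
have := rf_ge0 x0; rewrite le_eqVlt => /predU1P[<-|Phix].
  apply: (lt_le_trans d0); rewrite -[leLHS](rf_cst rPhi (ltW d0)).
  apply: (rf_mono rPhi) => [s|s]; first exact: ltW.
  by rewrite (le_trans _ (xy s))// lerDr.
have c0 : 0 < 1 + d / B by rewrite ltr_pwDl// divr_ge0// ltW.
apply: (@lt_le_trans _ _ ((1 + d / B) * Phi x)).
  by rewrite ltr_pMl// ltrDl divr_gt0.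
rewrite -(@rf_scale _ rPhi _ x (fun s => (1 + d / B) * x s))//; last exact: ltW.
apply: (rf_mono rPhi) => s; first by rewrite mulr_ge0// ltW.
rewrite (le_trans _ (xy s))// mulrDl mul1r lerD2l mulrAC ler_pdivrMr//.
by rewrite ler_pM2l.
Qed.

End Theory.

Definition expectation (p : lottery R S) x : R := \sum_s p s * x s.

Lemma expectation_ge0 p x : nonneg x -> 0 <= expectation p x.
Proof. by move=> x0; apply: sumr_ge0 => s _; rewrite mulr_ge0// lottery_ge0. Qed.

Lemma le_expectation p x y : (forall s, x s <= y s) ->
  expectation p x <= expectation p y.
Proof. by move=> xy; apply: ler_sum => s _; rewrite ler_wpM2l// lottery_ge0. Qed.

Lemma expectation_cst p c : expectation p (fun=> c) = c.
Proof. by rewrite /expectation -mulr_suml lottery_fin_sum mul1r. Qed.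

(** Convertible with [weighted_regret] at a regret vector, which is why [mwerE] holds by
    computation. *)
Definition weighted_sup (P : set (lottery R S * R)) x : R :=
  sup [set Pa.2 * expectation Pa.1 x | Pa in P].

Section WeightedSup.
Variable P : set (lottery R S * R).
Hypothesis wP : weighted_set P.

Lemma weight_itv Pa : P Pa -> 0 <= Pa.2 <= 1.
Proof. by case: Pa => p a; case: wP => + _ _; apply. Qed.

Lemma weighted_sup_has_sup x : nonneg x ->
  has_sup [set Pa.2 * expectation Pa.1 x | Pa in P].
Proof.
move=> x0; split.
  by case: wP => _ _ [p Pp]; exists (1 * expectation p x); exists (p, 1).
have [B B0 xB] := fin_bound x; exists B => _ [Pa PPa <-].
have /andP[a0 a1] := weight_itv PPa.
rewrite (le_trans (ler_piMl _ a1)) ?expectation_ge0//.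
by rewrite -[leRHS](expectation_cst Pa.1); apply: le_expectation.
Qed.

Lemma weighted_sup_ge Pa x : nonneg x -> P Pa ->
  Pa.2 * expectation Pa.1 x <= weighted_sup P x.
Proof.
move=> x0 PPa; apply: ub_le_sup; last by exists Pa.
by case: (weighted_sup_has_sup x0).
Qed.

Lemma weighted_sup_le b x : nonneg x ->
  (forall Pa, P Pa -> Pa.2 * expectation Pa.1 x <= b) -> weighted_sup P x <= b.
Proof.
move=> x0 xb; apply: sup_le_ub; first by case: (weighted_sup_has_sup x0).
by move=> _ [Pa PPa <-]; apply: xb.
Qed.

(** The conditions on weights enter through constants: weights at most 1 do not enlarge them, and a
    measure of weight 1 attains them. *)
Lemma weighted_sup_functional : regret_functional (weighted_sup P).
Proof.
have mono x y : nonneg x -> (forall s, x s <= y s) ->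
    weighted_sup P x <= weighted_sup P y.
  move=> x0 xy; have y0 s : 0 <= y s by apply: le_trans (xy s).
  apply: weighted_sup_le => // Pa PPa; apply: le_trans (weighted_sup_ge y0 PPa).
  by rewrite ler_wpM2l ?le_expectation//; case/andP: (weight_itv PPa).
(* One inequality suffices: for positive c the reverse one is the same statement for the inverse of
   c. *)
have le_scale c x y : 0 <= c -> nonneg x -> (forall s, y s = c * x s) ->
    weighted_sup P y <= c * weighted_sup P x.
  move=> c0 x0 yE; have y0 s : 0 <= y s by rewrite yE mulr_ge0.
  apply: weighted_sup_le => // Pa PPa.
  have -> : expectation Pa.1 y = c * expectation Pa.1 x.
    by rewrite /expectation mulr_sumr; apply: eq_bigr => s _; rewrite yE mulrCA.
  by rewrite mulrCA ler_wpM2l// weighted_sup_ge.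
split=> //.
- move=> c x y; rewrite le_eqVlt => /predU1P[<- x0 yE|c0 x0 yE].
    apply/eqP; rewrite eq_le le_scale//= mul0r.
    have y0 s : 0 <= y s by rewrite yE mul0r.
    case: wP => _ _ [p Pp].
    by apply: le_trans (weighted_sup_ge y0 Pp); rewrite mul1r expectation_ge0.
  apply/eqP; rewrite eq_le le_scale ?(ltW c0)//= -ler_pdivlMl//.
  apply: le_scale => [|s|s]; rewrite ?invr_ge0 ?(ltW c0)// yE.
    by rewrite mulr_ge0// ltW.
  by rewrite mulKf// gt_eqF.
- move=> x y z x0 y0 z0 zle; apply: weighted_sup_le => // Pa PPa.
  apply: le_trans (lerD (weighted_sup_ge x0 PPa) (weighted_sup_ge y0 PPa)).
  rewrite -mulrDr ler_wpM2l//; first by case/andP: (weight_itv PPa).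
  rewrite /expectation -big_split/=; apply: ler_sum => s _.
  by rewrite -mulrDr ler_wpM2l ?lottery_ge0.
- move=> c c0; apply/eqP; rewrite eq_le; apply/andP; split.
    apply: weighted_sup_le => // Pa PPa; rewrite expectation_cst.
    by rewrite ler_piMl//; case/andP: (weight_itv PPa).
  case: wP => _ _ [p Pp].
  have := @weighted_sup_ge _ (fun=> c) (fun=> c0) Pp.
  by rewrite /= mul1r expectation_cst.
Qed.

End WeightedSup.

End RegretFunctional.

(** * Hahn-Banach and the maximal weighted set *)

Section FiniteHahnBanach.
Context {R : realType} {S : finType}.
Local Notation V := (S -> R^o).
Implicit Types (q : V -> R) (v x y : V).

Record sublinear q : Prop := {
  subl_add : forall x y, q (x + y) <= q x + q y;
  subl_scale : forall c x, 0 < c -> q (c *: x) = c * q x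
}.

Lemma subl0 q : sublinear q -> q 0 = 0.
Proof.
move=> sq; have := @subl_scale _ sq 2 0 ltac:(by []).
by rewrite scaler0; lra.
Qed.

(* The largest sublinear functional below [q] that is linear along [v] and
   has the same value at [v]. *)
Definition linearize q v x : R :=
  inf [set q (x + t *: v) - t * q v | t in [set t | 0 <= t]].

Section Linearize.
Variables (q : V -> R) (v : V).
Hypothesis sq : sublinear q.

Lemma linearize_has_inf x :
  has_inf [set q (x + t *: v) - t * q v | t in [set t | 0 <= t]].
Proof.
split; first by exists (q (x + 0 *: v) - 0 * q v); exists 0 => /=.
(* Subadditivity at (x + tv) + (-x) = tv bounds all terms below, uniformly in t. *)
exists (- q (- x)) => _ [t /= t0 <-].
have -> : t * q v = q (t *: v).
  move: t0; rewrite le_eqVlt => /predU1P[<-|t0]; last by rewrite subl_scale.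
  by rewrite mul0r scale0r subl0.
have := subl_add sq (x + t *: v) (- x).
by rewrite addrAC subrr add0r; lra.
Qed.

Lemma linearize_le_shift x t : 0 <= t ->
  linearize q v x <= q (x + t *: v) - t * q v.
Proof. by move=> t0; apply: ge_inf; [case: (linearize_has_inf x)|exists t]. Qed.

Lemma linearize_ge x b :
  (forall t, 0 <= t -> b <= q (x + t *: v) - t * q v) -> b <= linearize q v x.
Proof.
move=> h; apply: lb_le_inf; first by case: (linearize_has_inf x).
by move=> _ [t t0 <-]; apply: h.
Qed.

Lemma linearize_le x : linearize q v x <= q x.
Proof.
have := @linearize_le_shift x 0 (lexx _).
by rewrite scale0r addr0 mul0r subr0.
Qed.

(** This is the term t = 1 of the infimum. With sublinearity it forces the new functional to be odd
    along v and to keep the value [q v] there. *)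
Lemma linearizeN : linearize q v (- v) <= - q v.
Proof.
have := @linearize_le_shift (- v) 1 ler01.
by rewrite scale1r addNr subl0// mul1r sub0r.
Qed.

Lemma linearize_sublinear : sublinear (linearize q v).
Proof.
(* The substitution of ct for t preserves the range of the infimum; the reverse inequality uses the
   inverse of c. *)
have scale_ge c x : 0 < c -> linearize q v (c *: x) <= c * linearize q v x.
  move=> c0; rewrite -ler_pdivrMl//; apply: linearize_ge => t t0; rewrite ler_pdivrMl//.
  rewrite mulrBr -(subl_scale sq _ c0) scalerDr scalerA mulrA.
  by apply: linearize_le_shift; rewrite mulr_ge0// ltW.
split=> [x y|c x c0].
  rewrite -lerBlDr; apply: linearize_ge => t t0.
  rewrite lerBlDr -lerBlDl; apply: linearize_ge => r r0; rewrite lerBlDl.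
  apply: le_trans (linearize_le_shift _ (addr_ge0 t0 r0)) _.
  rewrite scalerDl addrACA mulrDl.
  by have := subl_add sq (x + t *: v) (y + r *: v); lra.
apply/eqP; rewrite eq_le scale_ge//= -ler_pdivlMl//.
by apply: le_trans (scale_ge _ _ _); rewrite ?invr_gt0// scalerA mulVf ?gt_eqF// scale1r.
Qed.

End Linearize.

(** Oddness along w survives any further decrease: a smaller functional is smaller at -w and, after
    negation, larger at w. Hence the directions can be treated one at a time. *)
Lemma linearize_seq q (vs : seq V) : sublinear q ->
  exists q', [/\ sublinear q', forall x, q' x <= q x &
    forall v, v \in vs -> q' (- v) <= - q' v].
Proof.
move=> sq; elim: vs => [|v vs [q' [sq' q'q q'N]]]; first by exists q.
exists (linearize q' v); split=> [|x|w].
- exact: linearize_sublinear.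
- exact: le_trans (linearize_le v sq' x) (q'q x).
rewrite inE => /predU1P[-> {w}|/q'N wN].
  apply: le_trans (linearizeN v sq') _.
  by rewrite lerN2; apply: linearize_le.
apply: le_trans (linearize_le v sq' _) (le_trans wN _).
by rewrite lerN2; apply: linearize_le.
Qed.

Definition unit_fun (s : S) : V := fun s' => (s' == s)%:R.

(** On a finite S no transfinite extension is needed: a sublinear functional that is odd along all
    unit functions is linear. Linearizing along r beforehand secures equality at r. *)
Lemma hahn_banach q r : sublinear q ->
  exists c : S -> R, (forall x, \sum_s x s * c s <= q x) /\
    \sum_s r s * c s = q r.
Proof.
move=> sq.
have [q' [sq' q'q q'N]] :=
  linearize_seq [seq unit_fun s | s <- enum S] (linearize_sublinear r sq).
have q0N x : 0 <= q' x + q' (- x).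
  by have := subl_add sq' x (- x); rewrite subrr subl0.
have q'M s (a : R) : q' (a *: unit_fun s) = a * q' (unit_fun s).
  have e : q' (- unit_fun s) = - q' (unit_fun s).
    have us : unit_fun s \in [seq unit_fun s | s <- enum S].
      by apply: map_f; rewrite mem_enum.
    apply/eqP; rewrite eq_le q'N//=.
    by have := q0N (unit_fun s); lra.
  case: (ltrgt0P a) => [a0|a0|->].
  - by rewrite subl_scale.
  - by rewrite -{1}[a]opprK scaleNr -scalerN subl_scale ?oppr_gt0// e mulrNN.
  - by rewrite scale0r subl0// mul0r.
have le_sum x : q' x <= \sum_s x s * q' (unit_fun s).
  have {1}-> : x = \sum_s (x s *: unit_fun s).
    apply/funext => s; rewrite fct_sumE (bigD1 s)//= big1 => [|s' ns].
      by rewrite addr0 /unit_fun scalrfctE eqxx /GRing.scale/= mulr1.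
    by rewrite /unit_fun scalrfctE eq_sym (negbTE ns) scaler0.
  elim/big_rec2: _ => [|s a y _ IH]; first by rewrite subl0.
  by apply: le_trans (subl_add sq' _ _) _; rewrite q'M lerD2l.
exists (fun s => q' (unit_fun s)).
(* The bound [le_sum] at -x, combined with [q0N], is the opposite inequality at x. *)
have sum_le x : \sum_s x s * q' (unit_fun s) <= q' x.
  have := le_sum (- x).
  have -> : \sum_s (- x) s * q' (unit_fun s) = - \sum_s x s * q' (unit_fun s).
    by rewrite -sumrN; apply: eq_bigr => s _; rewrite -mulNr.
  by have := q0N x; lra.
split=> [x|]; first exact: le_trans (sum_le x) (le_trans (q'q x) (linearize_le _ sq _)).
apply/eqP; rewrite eq_le; apply/andP; split.
  exact: le_trans (sum_le r) (le_trans (q'q r) (linearize_le _ sq _)).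
apply: le_trans (le_sum r).
by have := linearizeN r sq; have := q'q (- r); have := q0N r; lra.
Qed.

End FiniteHahnBanach.

(** * The largest weighted set below a regret functional *)

Section MaximalWeights.
Context {R : realType} {S : finType}.
Variable Phi : (S -> R) -> R.
Hypothesis rPhi : regret_functional Phi.
Implicit Types (x : S -> R) (p : lottery R S).

Definition valid_weight p a :=
  0 <= a <= 1 /\ forall x, nonneg x -> a * expectation p x <= Phi x.

Definition max_weight p := sup [set a | valid_weight p a].

Lemma valid_weight_has_sup p : has_sup [set a | valid_weight p a].
Proof.
split; last by exists 1 => a [/andP[]].
by exists 0; split=> [|x x0]; rewrite ?lexx ?ler01// mul0r (rf_ge0 rPhi).
Qed.

Lemma le_max_weight p a : valid_weight p a -> a <= max_weight p.
Proof. by move=> pa; apply: ub_le_sup pa; case: (valid_weight_has_sup p). Qed.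

(** The constraints are closed in the weight, so they pass to the supremum. Vectors of expectation
    zero are set aside before dividing by the expectation. *)
Lemma max_weight_valid p : valid_weight p (max_weight p).
Proof.
have [ne _] := valid_weight_has_sup p.
split=> [|x x0].
  apply/andP; split; last by apply: sup_le_ub => // a [/andP[]].
  by apply: le_max_weight; split=> [|x x0]; rewrite ?lexx ?ler01// mul0r (rf_ge0 rPhi).
have := expectation_ge0 p x0; rewrite le_eqVlt => /predU1P[<-|ex0].
  by rewrite mulr0 (rf_ge0 rPhi).
rewrite -ler_pdivlMr//; apply: sup_le_ub => // a [_ /(_ x x0)].
by rewrite ler_pdivlMr.
Qed.

(** Every measure is included, possibly with weight 0, so that each competitor finds its measure
    here. *)
Definition max_weighted_set : set (lottery R S * R) :=
  [set Pa | Pa.2 = max_weight Pa.1].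

(** [Phi] is extended to all vectors through the positive part, which keeps it sublinear by
    monotonicity. A linear functional below the extension has nonnegative coefficients of total mass
    C at most 1; normalising them gives the measure, and C is its weight. *)
Lemma supporting_lottery r : nonneg r ->
  exists p a, valid_weight p a /\ Phi r <= a * expectation p r.
Proof.
move=> r0.
pose pos (x : S -> R) s : R := Num.max (x s) 0.
have pos0 x : nonneg (pos x) by move=> s; rewrite le_max lexx orbT.
have posE x : nonneg x -> pos x = x.
  by move=> x0; apply/funext => s; rewrite /pos max_l.
have sq : @sublinear R S (fun x => Phi (pos x)).
  split=> [x y|c x c0].
    apply: (rf_subadd rPhi) => // s.
    rewrite /pos ge_max addrfctE; apply/andP; split.
      by rewrite lerD ?le_max ?lexx.
    by rewrite addr_ge0 ?pos0.
  apply: (rf_scale rPhi) (ltW c0) (pos0 x) _ => s.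
  by rewrite /pos scalrfctE maxr_pMr ?(ltW c0)// mulr0.
have [c [cle cr]] := hahn_banach r sq; rewrite (posE r)// in cr.
(* The positive part of the negated unit function is zero, so the functional is at most 0 there. *)
have c0 s : 0 <= c s.
  have := cle (- unit_fun s); rewrite (bigD1 s)//= big1 => [|s' ns].
    have -> : pos (- unit_fun s) = (fun=> 0).
      apply/funext => s'; apply: max_r.
      by change (- (s' == s)%:R <= 0 :> R); rewrite oppr_le0 ler0n.
    rewrite (rf_cst rPhi)// opprfctE /unit_fun eqxx addr0 mulN1r; lra.
  by rewrite opprfctE /unit_fun (negbTE ns) oppr0 mul0r.
have csum : \sum_s c s <= 1.
  have := cle (fun=> 1); rewrite posE// (rf_cst rPhi)//.
  by under eq_bigr do rewrite mul1r.
have cxle x : nonneg x -> \sum_s c s * x s <= Phi x.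
  move=> x0; have := cle x; rewrite posE//.
  by under eq_bigr do rewrite mulrC.
have := sumr_ge0 (index_enum S) (P := xpredT) (fun s _ => c0 s).
(* With total mass zero there is nothing to normalise, but then [Phi r] is 0 and any measure with
   weight 0 will do. Some state exists because [Phi] separates the constants 0 and 1. *)
rewrite le_eqVlt => /predU1P[C0|C0].
  have cz s : c s = 0.
    apply/eqP; move/esym/eqP: C0; rewrite psumr_eq0// => /allP/(_ s).
    by rewrite mem_index_enum => /(_ isT).
  have [s0|noS] := pselect (exists s0 : S, True); last first.
    exfalso; have := rf_cst rPhi (ler01); rewrite (_ : (fun=> 1) = (fun=> 0)).
      by rewrite (rf_cst rPhi)//; lra.
    by apply/funext => s; case: noS; exists s.
  case: s0 => s0 _.
  have [||p pE] := @fin_lottery_exists R S (fun s => (s == s0)%:R) => //.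
    by rewrite (bigD1 s0)//= eqxx big1 ?addr0// => s /negbTE ->.
  exists p, 0; split; last by rewrite mul0r -cr big1// => s _; rewrite cz mulr0.
  by split=> [|x x0]; rewrite ?lexx ?ler01// mul0r (rf_ge0 rPhi).
set C := \sum_s c s in csum C0.
have [s|| p pE] := @fin_lottery_exists R S (fun s => c s / C).
- by rewrite divr_ge0// ltW.
- by rewrite -mulr_suml mulfV// gt_eqF.
have Ep x : C * expectation p x = \sum_s c s * x s.
  rewrite /expectation mulr_sumr; apply: eq_bigr => s _.
  by rewrite pE mulrA mulrCA mulfV ?mulr1// gt_eqF.
exists p, C; split; last by rewrite Ep -cr; under eq_bigr do rewrite mulrC.
by split=> [|x x0]; rewrite ?(ltW C0)// Ep cxle.
Qed.

Lemma max_weighted_setP : weighted_set max_weighted_set.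
Proof.
rewrite /max_weighted_set; split=> /= [p a ->|p a a' -> ->//|].
  by case: (max_weight_valid p).
(* Support at the constant 1 forces the weight up to 1. *)
have [p [a [pa le1]]] := @supporting_lottery (fun=> 1) (fun=> ler01).
exists p; apply/eqP; rewrite eq_le; apply/andP; split.
  move: le1; rewrite (rf_cst rPhi)// expectation_cst mulr1 => /le_trans; apply.
  exact: le_max_weight.
by case: (max_weight_valid p) => /andP[].
Qed.

Lemma max_weighted_supE x : nonneg x -> weighted_sup max_weighted_set x = Phi x.
Proof.
move=> x0; apply/eqP; rewrite eq_le; apply/andP; split.
  apply: (weighted_sup_le max_weighted_setP) => // -[p a].
  rewrite /max_weighted_set /= => ->.
  by case: (max_weight_valid p) => _ /(_ x x0).
have [p [a [pa le1]]] := supporting_lottery x0; apply: le_trans le1 _.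
apply: (@le_trans _ _ (max_weight p * expectation p x)).
  by rewrite ler_wpM2r ?expectation_ge0// le_max_weight.
exact: (@weighted_sup_ge _ _ _ max_weighted_setP (p, max_weight p)).
Qed.

(** Each weight occurring in P is valid for [Phi], because its term is below the supremum. *)
Lemma max_weighted_set_max P :
  weighted_set P -> (forall x, nonneg x -> weighted_sup P x = Phi x) ->
  forall p a, P (p, a) -> exists a', a <= a' /\ max_weighted_set (p, a').
Proof.
move=> wP PE p a Ppa; exists (max_weight p); split=> //; apply: le_max_weight.
split=> [|x x0]; first by case: wP => /(_ _ _ Ppa).
by rewrite -PE//; apply: (weighted_sup_ge wP x0 Ppa).
Qed.

End MaximalWeights.

(** * Utilities and soundness *)

Section Utility.
Context {R : realType} {Y : choiceType}.
Implicit Types (l : lottery R Y) (p : {i01 R}).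

Lemma clamp_subproof (t : R) : exists p : {i01 R}, 0 <= t <= 1 -> p%:num = t.
Proof.
have [/andP[t0 t1]|] := pselect (0 <= t <= 1); last by exists 0%:i01.
by exists (Itv01 t0 t1).
Qed.

(** Lets mixture weights be written as real expressions, with the bounds checked only when [clampE]
    is used; outside the unit interval the value is unspecified. *)
Definition clamp (t : R) : {i01 R} := sval (cid (clamp_subproof t)).

Lemma clampE (t : R) : 0 <= t <= 1 -> (clamp t)%:num = t.
Proof. exact: (svalP (cid (clamp_subproof t))). Qed.

Lemma clampE_open (t : R) : 0 < t < 1 -> (clamp t)%:num = t.
Proof. by case/andP=> t0 t1; rewrite clampE// !ltW. Qed.

Lemma convE p l l' y : (l <| p |> l') y = p%:num * l y + (1 - p%:num) * l' y.
Proof. exact: mixE. Qed.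

Lemma dirac_subproof (y : Y) : exists l : lottery R Y, forall z, l z = (z == y)%:R.
Proof.
have [||l lE] := @lottery_exists R Y [fset y]%fset (fun=> 1) => //.
  by rewrite big_seq_fset1.
by exists l => z; rewrite lE inE; case: eqP.
Qed.

Definition dirac (y : Y) : lottery R Y := sval (cid (dirac_subproof y)).

Lemma diracE y z : dirac y z = (z == y)%:R.
Proof. exact: (svalP (cid (dirac_subproof y))). Qed.

Variable U : Y -> R.

Lemma utility_fset (A : {fset Y}) l : (finsupp l `<=` A)%fset ->
  utility U l = \sum_(y <- A) l y * U y.
Proof.
move=> lA; apply/big_fset_incl => // y _.
by rewrite memNfinsupp => /eqP ->; rewrite mul0r.
Qed.

Lemma utility_conv p l l' :
  utility U (l <| p |> l') = p%:num * utility U l + (1 - p%:num) * utility U l'.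
Proof.
pose A := (finsupp l `|` finsupp l')%fset.
rewrite (@utility_fset A); last first.
  apply/fsubsetP => y; rewrite mem_finsupp convE; apply: contraNT.
  rewrite inE negb_or !memNfinsupp => /andP[/eqP-> /eqP->].
  by rewrite !mulr0 addr0.
rewrite (@utility_fset A l) ?fsubsetUl// (@utility_fset A l') ?fsubsetUr//.
rewrite !mulr_sumr -big_split/=; apply: eq_bigr => y _.
by rewrite convE mulrDl !mulrA.
Qed.

Lemma utility_dirac y : utility U (dirac y) = U y.
Proof.
rewrite (@utility_fset [fset y]%fset) ?big_seq_fset1 ?diracE ?eqxx ?mul1r//.
apply/fsubsetP => z; rewrite mem_finsupp diracE inE.
by rewrite pnatr_eq0; case: (z == y).
Qed.

(** Induction on the size of the support: one prize y is split off, and the rest, renormalised by 1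
    - l(y), has smaller support. A point mass is treated apart since the renormalisation would
    divide by zero. *)
Lemma affine_utility (u : lottery R Y -> R) :
  (forall p l l', u (l <| p |> l') = p%:num * u l + (1 - p%:num) * u l') ->
  (forall y, u (dirac y) = U y) -> forall l, u l = utility U l.
Proof.
move=> uconv udirac l.
have [n] := ubnP #|` finsupp l|; elim: n l => // n IH l; rewrite ltnS => ln.
have [l0|/fset0Pn[y yl]] := eqVneq (finsupp l) fset0.
  by have := lottery_sum l; rewrite l0 big_seq_fset0 => /eqP; rewrite eq_sym oner_eq0.
have ly : l y != 0 by rewrite -mem_finsupp.
pose B := (finsupp l `\ y)%fset.
have lsum : l y + \sum_(z <- B) l z = 1.
  by rewrite -(lottery_sum l) [RHS](big_fsetD1 y).
have B0 z : 0 <= l z by exact: lottery_ge0.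
have [ly1|ly1] := eqVneq (l y) 1.
  have -> : l = dirac y; last by rewrite udirac utility_dirac.
  apply: lotteryP => z; rewrite diracE; have [->//|zy] := eqVneq z y.
  have [zl|] := boolP (z \in finsupp l); last by rewrite memNfinsupp => /eqP.
  have zB : z \in B by rewrite !inE zy.
  have : \sum_(z <- B) l z = 0 by move: lsum; rewrite ly1; lra.
  rewrite (big_fsetD1 z)//= => /eqP.
  by rewrite paddr_eq0 ?sumr_ge0// => /andP[/eqP].
have ly_lt1 : l y < 1.
  rewrite lt_neqAle ly1 -subr_ge0 -lsum addrC addKr.
  by rewrite sumr_ge0.
have ly01 : 0 <= l y <= 1 by rewrite B0 ltW.
have [z zB||l' l'E] := @lottery_exists R Y B (fun z => l z / (1 - l y)).
- by rewrite divr_ge0// subr_ge0 ltW.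
- rewrite -mulr_suml (_ : \sum_(z <- B) l z = 1 - l y); last by rewrite -lsum addrC addKr.
  by rewrite mulfV// subr_eq0 eq_sym.
have lE : l = dirac y <| clamp (l y) |> l'.
  apply: lotteryP => z; rewrite convE clampE// diracE l'E !inE.
  have [->|zy]/= := eqVneq z y; first by rewrite mulr1 mulr0 addr0.
  rewrite mulr0 add0r; case: ifPn => [_|]; last by rewrite memNfinsupp mulr0 => /eqP.
  by rewrite mulrC mulfVK// subr_eq0 eq_sym.
rewrite lE uconv utility_conv udirac utility_dirac IH//.
apply: leq_trans ln; rewrite [X in (_ < X)%N](cardfsD1 y) yl add1n ltnS.
apply: fsubset_leq_card; apply/fsubsetP => z; rewrite mem_finsupp l'E -/B.
by case: ifP => //; rewrite eqxx.
Qed.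

End Utility.

(** * Regret under mixtures and changes of menu *)

Section Regret.
Context {R : realType} {S : finType} {Y : choiceType}.
Local Notation act := (act R S Y).
Variable U : Y -> R.
Implicit Types (M : set act) (f g h : act) (l : lottery R Y) (p : {i01 R}).
Local Notation u := (utility U).
Local Notation reg := (state_regret U).
Local Notation sup_utility M s := (sup (menu_utilities U M s)).

Lemma le_sup_utility M f s : utility_bounded U M -> M f ->
  u (f s) <= sup_utility M s.
Proof. by move=> bM Mf; apply: ub_le_sup; [apply: bM|exists f]. Qed.

Lemma sup_utility_le M s b : M !=set0 -> (forall f, M f -> u (f s) <= b) ->
  sup_utility M s <= b.
Proof.
move=> [f Mf] Mb; apply: sup_le_ub; first by exists (u (f s)); exists f.
by move=> _ [g Mg <-]; apply: Mb.
Qed.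

Lemma regret_ge0 M f : utility_bounded U M -> M f -> nonneg (reg M f).
Proof. by move=> bM Mf s; rewrite subr_ge0 le_sup_utility. Qed.

(** Regret sees the menu only through statewise suprema. This serves adjoined mixtures as well as
    never strictly optimal acts. *)
Lemma regret_setU M N f : utility_bounded U M -> M !=set0 ->
  (forall h s, N h -> u (h s) <= sup_utility M s) -> reg (M `|` N) f = reg M f.
Proof.
move=> bM M0 NM; apply/funext => s; rewrite /state_regret; congr (_ - _).
have ubMN h : (M `|` N) h -> u (h s) <= sup_utility M s.
  by case=> [Mh|Nh]; [apply: le_sup_utility|apply: NM].
apply/eqP; rewrite eq_le; apply/andP; split.
  by apply: sup_utility_le ubMN; case: M0 => g Mg; exists g; left.
apply: sup_utility_le => // g Mg; apply: ub_le_sup; last by exists g; [left|].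
by exists (sup_utility M s) => _ [h Nh <-]; apply: ubMN.
Qed.

Lemma utility_mix_act p f g s :
  u (mix_act p f g s) = p%:num * u (f s) + (1 - p%:num) * u (g s).
Proof. exact: utility_conv. Qed.

Lemma regret_mix M p f g s :
  reg M (mix_act p f g) s = p%:num * reg M f s + (1 - p%:num) * reg M g s.
Proof. by rewrite /state_regret utility_mix_act; ring. Qed.

Lemma le_sup_utility_mix M p f g s : utility_bounded U M -> M f -> M g ->
  u (mix_act p f g s) <= sup_utility M s.
Proof.
move=> bM Mf Mg; rewrite utility_mix_act.
have p0 : 0 <= p%:num :> R by [].
have p1 : 0 <= 1 - p%:num :> R by rewrite subr_ge0.
have := lerD (ler_wpM2l p0 (le_sup_utility s bM Mf))
  (ler_wpM2l p1 (le_sup_utility s bM Mg)).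
by move/le_trans; apply; lra.
Qed.

Lemma utility_bounded_mix M p h : utility_bounded U M ->
  utility_bounded U (mix_menu p M h).
Proof.
move=> bM s; have [b Mb] := bM s; exists (p%:num * b + (1 - p%:num) * u (h s)).
move=> _ [_ [f Mf <-] <-]; rewrite utility_mix_act lerD2r ler_wpM2l//.
by apply: Mb; exists f.
Qed.

(** The contribution of h shifts supremum and utility alike and cancels; independence thus becomes
    homogeneity of the functional. *)
Lemma regret_mix_menu M p f h s : 0 < p%:num -> utility_bounded U M -> M f ->
  reg (mix_menu p M h) (mix_act p f h) s = p%:num * reg M f s.
Proof.
move=> p0 bM Mf; rewrite /state_regret utility_mix_act.
suff -> : sup_utility (mix_menu p M h) s =
    p%:num * sup_utility M s + (1 - p%:num) * u (h s) by ring.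
apply/eqP; rewrite eq_le; apply/andP; split.
  apply: sup_utility_le => [|_ [g Mg <-]].
    by exists (mix_act p f h); exists f.
  by rewrite utility_mix_act lerD2r ler_wpM2l// le_sup_utility.
rewrite -lerBrDr -ler_pdivlMl//; apply: sup_utility_le => [|g Mg].
  by exists f.
rewrite ler_pdivlMl// lerBrDr -utility_mix_act.
by apply: le_sup_utility; [apply: utility_bounded_mix|exists g].
Qed.

Lemma utility_bounded_menu_system : menu_system (@utility_bounded R S Y U).
Proof.
split=> [f s|M N bM bN s|p M h _]; last exact: utility_bounded_mix.
  by exists (u (f s)) => _ [_ -> <-].
have [[b Mb] [c Nc]] := (bM s, bN s).
exists (Num.max b c) => _ [f [Mf|Nf] <-]; rewrite le_max.
  by rewrite Mb//; exists f.
by rewrite orbC Nc//; exists f.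
Qed.

Lemma lottery_max (s0 : S) f : exists l, forall s, u (f s) <= u l.
Proof.
exists (f [arg max_(s > s0) u (f s)]%O) => s.
by case: arg_maxP => // s1 _; apply.
Qed.

(** The state guards against a degenerate case: with no states and no prizes there is an act, but no
    lottery to bound its menu. *)
Lemma lottery_bounded_menu_system : S -> menu_system (@lottery_bounded R S Y U).
Proof.
move=> s0; split=> [f|M N [b Mb] [c Nc]|p M h _ [b Mb]].
- by have [l lf] := lottery_max s0 f; exists l => _ s ->.
- have [bc|/ltW cb] := leP (u b) (u c); [exists c|exists b] => f s [Mf|Nf].
  + exact: le_trans (Mb _ _ Mf) bc.
  + exact: Nc.
  + exact: Mb.
  + exact: le_trans (Nc _ _ Nf) cb.
- have [l lh] := lottery_max s0 h; exists (b <| p |> l) => _ s [f Mf <-].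
  by rewrite utility_mix_act utility_conv lerD// ler_wpM2l// Mb.
Qed.

Lemma lottery_bounded_utility M : lottery_bounded U M -> utility_bounded U M.
Proof. by case=> l Ml s; exists (u l) => _ [f Mf <-]; apply: Ml. Qed.

Variable P : set (lottery R S * R).
Hypothesis wP : weighted_set P.
Local Notation Phi := (weighted_sup P).
Let rPhi := weighted_sup_functional wP.

Lemma mwerE M f g : mwer U P M f g = (Phi (reg M f) <= Phi (reg M g)).
Proof. by []. Qed.

Lemma strict_mwerE M f g :
  strict (mwer U P) M f g <-> Phi (reg M f) < Phi (reg M g).
Proof.
rewrite /strict !mwerE; split; first by case=> _ /negP; rewrite -ltNge.
by move=> fg; split; [exact: ltW|apply/negP; rewrite -ltNge].
Qed.

(** The regrets of two constant acts differ by the same amount in every state, so [rf_strict]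
    applies; a gap in a single state could be missed by all measures. *)
Lemma mwer_const M l l' : utility_bounded U M -> M (const_act l) ->
  M (const_act l') -> mwer U P M (const_act l) (const_act l') <-> u l' <= u l.
Proof.
move=> bM Ml Ml'; rewrite mwerE; split=> [|ll']; last first.
  by apply: (rf_mono rPhi); [exact: regret_ge0|move=> s; rewrite lerD2l lerN2].
apply: contraLR; rewrite -!ltNge -subr_gt0 => ll'.
apply: (rf_strict rPhi ll'); first exact: regret_ge0.
by move=> s; rewrite /state_regret /const_act; lra.
Qed.

(** * Soundness of the axioms *)

Section Soundness.
Variable menus : set (set act).
Hypothesis mmenus : menu_system menus.
Hypothesis bmenus : forall M, menus M -> utility_bounded U M.

Lemma const_pref_mwer l l' : const_pref (mwer U P) l l' <-> u l' <= u l.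
Proof.
apply: mwer_const; [|by left|by right].
by apply: bmenus; apply: menu_setU => //; apply: menu_set1.
Qed.

Lemma mwer_axioms1_9 : (exists y y', U y != U y') -> axioms1_9 menus (mwer U P).
Proof.
move=> [y [y' Uyy']]; split.
- by move=> M f g h _ _ _ _; apply: le_trans.
- by move=> M f g _ _ _; rewrite !mwerE; apply/orP; apply: le_total.
- wlog Uy : y y' {Uyy'} / U y < U y'.
    move=> W; have [/W|/W|e] := ltgtP (U y) (U y'); [exact|exact|].
    by rewrite e eqxx in Uyy'.
  have m2 : menus [set const_act (dirac y'); const_act (dirac y)].
    by apply: menu_setU => //; apply: menu_set1.
  exists [set const_act (dirac y'); const_act (dirac y)].
  exists (const_act (dirac y')), (const_act (dirac y)).
  split=> //; [by left|by right|].
  split; first by apply/const_pref_mwer; rewrite !utility_dirac ltW.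
  rewrite mwer_const; [|exact: bmenus|by right|by left].
  by rewrite !utility_dirac leNgt Uy.
- move=> M f g mM Mf Mg fg; rewrite mwerE; apply: (rf_mono rPhi) => s.
    by apply: regret_ge0 => //; apply: bmenus.
  by rewrite lerD2l lerN2; apply/const_pref_mwer.
- move=> M f g h /bmenus bM Mf Mg Mh /strict_mwerE fg /strict_mwerE gh.
  have [f0 g0 h0] : [/\ nonneg (reg M f), nonneg (reg M g) & nonneg (reg M h)].
    by split; apply: regret_ge0.
  have := rf_ge0 rPhi g0; set Pf := Phi (reg M f) in fg *.
  set Pg := Phi (reg M g) in fg gh *; set Ph := Phi (reg M h) in gh * => Pg0.
  (* [q] solves q Pf + (1 - q) Ph = (Pf + Pg)/2, which is below Pg, and convexity bounds the mixture
     from above. Convexity gives no lower bound, so [r] solves (1 - r) Ph = (Ph + Pg)/2, and the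
     mixture is bounded below by dropping the regret of f. *)
  pose q := 1 - (Pg - Pf) / (2 * (Ph - Pf)); pose r := (Ph - Pg) / (2 * Ph).
  have q01 : 0 < q < 1.
    rewrite /q subr_gt0 gtrBl divr_gt0 ?mulr_gt0 ?subr_gt0//; last exact: lt_trans gh.
    by rewrite ltr_pdivrMr ?mulr_gt0 ?subr_gt0//; [lra|exact: lt_trans gh].
  have r01 : 0 < r < 1.
    have Ph0 : 0 < Ph by exact: le_lt_trans gh.
    by rewrite divr_gt0 ?mulr_gt0 ?subr_gt0//= ltr_pdivrMr ?mulr_gt0//; lra.
  have mixE p g' : reg (M `|` [set mix_act p f h]) g' = reg M g'.
    apply: regret_setU => //; first by exists f.
    by move=> _ s ->; apply: le_sup_utility_mix.
  have mix0 p : nonneg (reg M (mix_act p f h)).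
    by move=> s; rewrite subr_ge0 le_sup_utility_mix.
  exists (clamp q), (clamp r); rewrite !clampE_open//.
  split=> //; apply/strict_mwerE; rewrite !mixE.
  + have qq : 0 <= q <= 1 by case/andP: q01 => *; rewrite !ltW.
    have /le_lt_trans : Phi (reg M (mix_act (clamp q) f h)) <= q * Pf + (1 - q) * Ph.
      apply: (rf_convex rPhi) => // s; by rewrite regret_mix clampE.
    apply; rewrite -/Pg /q.
    have -> : (1 - (Pg - Pf) / (2 * (Ph - Pf))) * Pf +
        (1 - (1 - (Pg - Pf) / (2 * (Ph - Pf)))) * Ph = (Pf + Pg) / 2.
      by field; rewrite subr_eq0 gt_eqF// (lt_trans fg).
    by lra.
  + have Ph0 : 0 < Ph by exact: le_lt_trans gh.
    have /lt_le_trans : Pg < (1 - r) * Ph.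
      have -> : (1 - r) * Ph = (Ph + Pg) / 2 by rewrite /r; field; rewrite gt_eqF.
      by lra.
    apply; case/andP: r01 => r0 r1.
    rewrite -(@rf_scale _ _ _ rPhi (1 - r) (reg M h)
      (fun s => (1 - r) * reg M h s))//; last first.
      by rewrite subr_ge0 ltW.
    apply: (rf_mono rPhi) => s; first by rewrite mulr_ge0// subr_ge0 ltW.
    by rewrite regret_mix clampE_open ?r0// lerDr mulr_ge0// ltW.
- move=> M f g p /bmenus bM Mf Mg p01 [fg gf]; rewrite mwerE !regret_setU//; first last.
  + by move=> _ s ->; apply: le_sup_utility_mix.
  + by exists f.
  + by move=> _ s ->; apply: le_sup_utility_mix.
  + by exists f.
  have f0 := regret_ge0 bM Mf; have g0 := regret_ge0 bM Mg.
  have pp : 0 <= (p%:num : R) <= 1 by apply/andP.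
  have m0 : nonneg (reg M (mix_act p f g)).
    by move=> s; rewrite subr_ge0 le_sup_utility_mix.
  have : Phi (reg M (mix_act p f g)) <=
      p%:num * Phi (reg M f) + (1 - p%:num) * Phi (reg M g).
    by apply: (rf_convex rPhi) => // s; rewrite regret_mix.
  have : p%:num * Phi (reg M f) <= p%:num * Phi (reg M g) by rewrite ler_wpM2l.
  by lra.
- move=> M f g h p /bmenus bM Mf Mg /andP[p0 _]; rewrite !mwerE.
  have e k : M k -> Phi (reg (mix_menu p M h) (mix_act p k h)) = p%:num * Phi (reg M k).
    move=> Mk; apply: (rf_scale rPhi) => // [|s]; first exact: regret_ge0.
    exact: regret_mix_menu.
  by rewrite !e// ler_pM2l.
- by move=> M M' l l' /bmenus bM /bmenus bM' *; rewrite !mwer_const.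
- move=> M M' f g /bmenus bM /bmenus bM' Mf Mg never.
  rewrite !mwerE !regret_setU//; try by exists f.
  + move=> h s /never/(_ s)[k Mk] /const_pref_mwer hk.
    by apply: le_trans hk _; apply: le_sup_utility.
  + move=> h s /never/(_ s)[k Mk] /const_pref_mwer hk.
    by apply: le_trans hk _; apply: le_sup_utility.
Qed.

End Soundness.
End Regret.

(** * The von Neumann-Morgenstern theorem *)

(** An intermediate value principle in order form, applied at the supremum of [lo]: if [hi] failed
    there, [lo] would hold further up; if [lo] failed, it would stop strictly earlier. Mixture
    continuity supplies both hypotheses. *)
Lemma crossing (R : realType) (N : R) (lo hi : R -> Prop) : 0 <= N -> lo 0 ->
  (forall c, 0 <= c <= N -> ~ hi c -> exists c', [/\ c < c', c' <= N & lo c']) ->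
  (forall c, 0 <= c <= N -> ~ lo c ->
    exists2 c', c' < c & forall d, 0 <= d <= N -> lo d -> d <= c') ->
  exists c, [/\ 0 <= c <= N, lo c & hi c].
Proof.
move=> N0 lo0 nhi nlo; pose A := [set c | 0 <= c <= N /\ lo c].
have A0 : A 0 by split=> //; rewrite lexx.
have supA : has_sup A by split; [exists 0|exists N => c [/andP[]]].
have cN : 0 <= sup A <= N.
  rewrite ub_le_sup//=; last by case: supA.
  by apply: sup_le_ub; [case: supA|move=> c [/andP[]]].
exists (sup A); split=> //; apply: contrapT.
  move=> /(nlo _ cN)[c' c'A Ac']; move: c'A; apply/negP; rewrite -leNgt.
  by apply: sup_le_ub; [case: supA|move=> d [? ?]; apply: Ac'].
move=> /(nhi _ cN)[c' [c'A c'N lo_c']].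
suff : c' <= sup A by rewrite leNgt c'A.
apply: ub_le_sup; first by case: supA.
split=> //; rewrite c'N andbT; apply: le_trans (ltW c'A).
by case/andP: cN.
Qed.

Section VonNeumannMorgenstern.
Context {R : realType} {Y : choiceType}.
Local Notation lottery := (lottery R Y).
Implicit Types (a b l m : lottery) (p : {i01 R}) (s t x z : R).
Variable pr : lottery -> lottery -> Prop.
Hypothesis pr_total : forall l l', pr l l' \/ pr l' l.
Hypothesis pr_trans : forall l l' l'', pr l l' -> pr l' l'' -> pr l l''.
Hypothesis pr_indep : forall p l l' m, 0 < p%:num < 1 ->
  pr l l' <-> pr (l <| p |> m) (l' <| p |> m).
Hypothesis pr_cont : forall l l' l'', ~ pr l' l -> ~ pr l'' l' ->
  exists q r : {i01 R}, [/\ 0 < q%:num < 1, 0 < r%:num < 1,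
    ~ pr l' (l <| q |> l'') & ~ pr (l <| r |> l'') l'].

Let pr_refl l : pr l l. Proof. by case: (pr_total l l). Qed.

Let npr l l' : ~ pr l l' -> pr l' l. Proof. by case: (pr_total l l'). Qed.

Let eqv l l' := pr l l' /\ pr l' l.

Let pr_eqv l l' m m' : eqv l m -> eqv l' m' -> pr l l' <-> pr m m'.
Proof.
move=> [lm1 ml1] [lm2 ml2]; split=> h.
  exact: pr_trans ml1 (pr_trans h lm2).
exact: pr_trans lm1 (pr_trans h ml2).
Qed.

Let lm t l l' : lottery := l <| clamp t |> l'.

Let lmE t l l' y : 0 <= t <= 1 -> lm t l l' y = t * l y + (1 - t) * l' y.
Proof. by move=> t01; rewrite convE clampE. Qed.

Let lm_one l l' : lm 1 l l' = l.
Proof. by apply: lotteryP => y; rewrite lmE ?lexx ?ler01//; ring. Qed.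

Let lmm t l : lm t l l = l. Proof. exact: convmm. Qed.

Let lm_indep t l l' m : 0 < t <= 1 -> pr l l' <-> pr (lm t l m) (lm t l' m).
Proof.
move=> /andP[t0]; rewrite le_eqVlt => /predU1P[->|t1]; first by rewrite !lm_one.
by apply: pr_indep; rewrite clampE_open ?t0.
Qed.

Let conv_eqv p l l' m m' : eqv l m -> eqv l' m' -> eqv (l <| p |> l') (m <| p |> m').
Proof.
move=> [lm1 ml1] [lm2 ml2].
have [->|p0] := eqVneq p 0%:i01; first by rewrite !conv0.
have [->|p1] := eqVneq p 1%:i01; first by rewrite !conv1.
have p01 : 0 < p%:num < 1.
  by rewrite !lt_neqAle eq_sym ge0 le1 !andbT; apply/andP; split; apply/eqP => e;
    [case/eqP: p0|case/eqP: p1]; apply/val_inj.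
have q01 : 0 < (1 - p%:inum)%:i01%:num < 1 by case/andP: p01 => *; rewrite /=; lra.
suff convS l1 l2 m1 m2 : pr l1 m1 -> pr l2 m2 -> pr (l1 <| p |> l2) (m1 <| p |> m2).
  by split; apply: convS.
(* The components are replaced one at a time, the second after swapping the mixture. *)
move=> h1 h2; apply: (@pr_trans _ (m1 <| p |> l2)).
  exact: (pr_indep l1 m1 l2 p01).1.
rewrite !(convC p m1).
exact: (pr_indep l2 m2 m1 q01).1.
Qed.

Variables (a b : lottery).
Hypothesis ab : ~ pr b a.

Let path t : lottery := lm t a b.

Let pathE t y : 0 <= t <= 1 -> path t y = t * a y + (1 - t) * b y.
Proof. exact: lmE. Qed.

Let path0 : path 0 = b.
Proof. by apply: lotteryP => y; rewrite pathE ?lexx ?ler01//; ring. Qed.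

Let path1 : path 1 = a. Proof. exact: lm_one. Qed.

(** Independence is used twice: [path t] beats b because a does, and [path s] is a mixture of b with
    [path t], where b has weight 1 - s/t. *)
Let path_lt s t : 0 <= s <= 1 -> 0 <= t <= 1 -> s < t -> ~ pr (path s) (path t).
Proof.
move=> /andP[s0 s1] /andP[t0 t1] st; have t_gt0 : 0 < t by exact: le_lt_trans st.
have tb : ~ pr b (path t).
  rewrite -{1}(lmm t b) => h; apply: ab.
  by apply: (lm_indep _ _ b _).2 h; rewrite t_gt0.
pose w := 1 - s / t.
have w01 : 0 < w <= 1.
  by rewrite subr_gt0 ltr_pdivrMr// mul1r st gerBl divr_ge0.
have -> : path s = lm w b (path t).
  apply: lotteryP => y; rewrite lmE; last by case/andP: w01 => /ltW -> ->.
  by rewrite !pathE ?s0 ?t0// /w; field; rewrite gt_eqF.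
by rewrite -{2}(lmm w (path t)) => /(lm_indep _ _ _ w01).2.
Qed.

Let path_le s t : 0 <= s <= 1 -> 0 <= t <= 1 -> pr (path t) (path s) <-> s <= t.
Proof.
move=> s01 t01; split=> [|st].
  by apply: contraPP => /negP; rewrite -ltNge; apply: path_lt.
move: st; rewrite le_eqVlt => /predU1P[->//|st].
by apply: npr; apply: path_lt.
Qed.

Let between l : pr a l -> pr l b -> exists t, 0 <= t <= 1 /\ eqv l (path t).
Proof.
move=> al lb.
have [|||t [t01 lo hi]] :=
  @crossing R 1 (fun c => pr l (path c)) (fun c => pr (path c) l) ler01.
- by rewrite path0.
- move=> c /andP[c0 c1] nhi.
  have {}c1 : c < 1.
    by rewrite lt_neqAle c1 andbT; apply/eqP => e; apply: nhi; rewrite e path1.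
  (* If l is as good as a, one may move to the end of the segment at once; otherwise mixing a little
     of a into [path c] stays below l. *)
  have [la|la] := pselect (pr l a); first by exists 1; rewrite path1.
  have [q [r [_ /andP[r0 r1] _ lr]]] := pr_cont la nhi.
  have c01 : 0 <= c <= 1 by rewrite c0 ltW.
  have e01 : c < r%:num + (1 - r%:num) * c < 1.
    have := mulr_gt0 r0 (_ : 0 < 1 - c); rewrite subr_gt0 => /(_ c1).
    have := mulr_gt0 (_ : 0 < 1 - r%:num) (_ : 0 < 1 - c).
    rewrite !subr_gt0 => /(_ r1 c1).
    by lra.
  exists (r%:num + (1 - r%:num) * c); case/andP: e01 => e0 e1.
  split=> //; first exact: ltW.
  have -> : path (r%:num + (1 - r%:num) * c) = a <| r |> path c; last exact: npr.
  apply: lotteryP => y; rewrite convE !pathE//; first by ring.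
  by rewrite (ltW e1) andbT (le_trans c0 (ltW e0)).
- move=> c /andP[c0 c1] nlo.
  have c_gt0 : 0 < c.
    by rewrite lt_neqAle c0 andbT; apply/eqP => e; apply: nlo; rewrite -e path0.
  have c01 : 0 <= c <= 1 by rewrite c0.
  have [bl|bl] := pselect (pr b l).
    exists 0 => // d /andP[d0 d1] ld; rewrite leNgt; apply/negP => d_gt0.
    apply: (@path_lt 0 d); rewrite ?lexx ?ler01 ?d0//.
    by rewrite path0; apply: pr_trans bl ld.
  have [q [r [/andP[q0 q1] _ ql _]]] := pr_cont nlo bl.
  exists (q%:num * c) => [|d d01 ld]; first by rewrite gtr_pMl.
  rewrite leNgt; apply/negP => qd.
  have qc01 : 0 <= q%:num * c <= 1.
    by rewrite mulr_ge0//= mulr_ile1.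
  apply: (path_lt qc01 d01 qd).
  have e : path (q%:num * c) = path c <| q |> b.
    by apply: lotteryP => y; rewrite convE !pathE//; ring.
  by apply: pr_trans ld; rewrite e; apply: npr.
by exists t; split.
Qed.

(** Parametrises the segment by [-1,1], so that its midpoint has value 0 and shrinking towards it
    multiplies values. *)
Let lam z : lottery := path ((1 + z) / 2).

Let lam_itv z : `|z| <= 1 -> 0 <= (1 + z) / 2 <= 1.
Proof. by rewrite ler_norml => /andP[? ?]; apply/andP; split; lra. Qed.

Let lam_le z z' : `|z| <= 1 -> `|z'| <= 1 -> pr (lam z') (lam z) <-> z <= z'.
Proof.
move=> z1 z'1; rewrite path_le ?lam_itv//.
by split; lra.
Qed.

Let lam_conv p z z' : `|z| <= 1 -> `|z'| <= 1 ->
  lam z <| p |> lam z' = lam (p%:num * z + (1 - p%:num) * z').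
Proof.
move=> z1 z'1.
have [p0 p1] : 0 <= p%:num :> R /\ 0 <= 1 - p%:num :> R by rewrite subr_ge0.
have w1 : `|p%:num * z + (1 - p%:num) * z'| <= 1.
  apply: le_trans (ler_normD _ _) _; rewrite !normrM (ger0_norm p0) (ger0_norm p1).
  have := lerD (ler_wpM2l p0 z1) (ler_wpM2l p1 z'1).
  by move/le_trans; apply; lra.
by apply: lotteryP => y; rewrite convE !pathE ?lam_itv//; field.
Qed.

Let m0 := lam 0.

(* l has utility x if shrinking l by some factor t towards the midpoint m0 of
   the segment from b to a yields a point equivalent to lam (t * x). *)
Let val_at l x t := [/\ 0 < t <= 1, `|t * x| <= 1 & eqv (lm t l m0) (lam (t * x))].

(** Mixing once more with the midpoint multiplies both factor and value by t'/t. Any two lotteries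
    can therefore be compared at a common factor. *)
Let val_at_down l x t t' : val_at l x t -> 0 < t' <= t -> val_at l x t'.
Proof.
move=> [/andP[t0 t1] tx e] /andP[t'0 t't].
have w01 : 0 <= t' / t <= 1.
  by rewrite divr_ge0 ?(ltW t0) ?(ltW t'0)//= ler_pdivrMr// mul1r.
have t'x : t' * x = t' / t * (t * x) + (1 - t' / t) * 0.
  by field; rewrite gt_eqF.
split.
- by rewrite t'0 (le_trans t't).
- rewrite t'x mulr0 addr0 normrM ger0_norm; last by case/andP: w01.
  by rewrite mulr_ile1//; case/andP: w01.
- have -> : lm t' l m0 = lm t l m0 <| clamp (t' / t) |> m0.
    have t01 : 0 <= t <= 1 by rewrite ltW.
    have t'01 : 0 <= t' <= 1 by rewrite ltW//= (le_trans t't).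
    apply: lotteryP => y; rewrite convE (lmE _ _ _ t01) (lmE _ _ _ t'01) clampE//.
    by field; rewrite gt_eqF.
  have -> : lam (t' * x) = lam (t * x) <| clamp (t' / t) |> lam 0.
    by rewrite lam_conv ?normr0// clampE// -t'x.
  by apply: conv_eqv => //; split; apply: pr_refl.
Qed.

Let val_common l l' x x' t t' : val_at l x t -> val_at l' x' t' ->
  exists t0, val_at l x t0 /\ val_at l' x' t0.
Proof.
move=> v v'; exists (Num.min t t').
have [[/andP[t0 _] _ _] [/andP[t'0 _] _ _]] := (v, v').
by split; [apply: val_at_down v _|apply: val_at_down v' _];
  rewrite lt_min t0 t'0 ge_min lexx ?orbT.
Qed.

Let val_le l l' x x' t t' : val_at l x t -> val_at l' x' t' -> pr l l' <-> x' <= x.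
Proof.
move=> v v'; have [s [[s01 sx e] [_ sx' e']]] := val_common v v'.
rewrite (lm_indep l l' m0 s01) (pr_eqv e e') lam_le// ler_pM2l//.
by case/andP: s01.
Qed.

Let val_exists l : exists x t, val_at l x t.
Proof.
have one : `|1 : R| <= 1 by rewrite normr1.
have zero : `|0 : R| <= 1 by rewrite normr0.
have negone : `|- 1 : R| <= 1 by rewrite normrN normr1.
have lam1 : lam 1 = a by rewrite -path1; congr path; lra.
have lamN1 : lam (- 1) = b by rewrite -path0; congr path; lra.
have m0a : ~ pr m0 a by rewrite -lam1 lam_le// => h; lra.
have bm0 : ~ pr b m0 by rewrite -lamN1 lam_le// => h; lra.
have [t [t01 at_ tb]] : exists t, [/\ 0 < t <= 1, pr a (lm t l m0) & pr (lm t l m0) b].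
  have [al|al] := pselect (pr a l); have [lb|lb] := pselect (pr l b).
  - by exists 1; rewrite lm_one ltr01 lexx.
  (* Here l is worse than b. Continuity brings the mixture with the midpoint above b, and
     independence keeps it below the midpoint, hence below a. The next case is the mirror image. *)
  - have [q [_ [q01 _ qb _]]] := pr_cont bm0 lb.
    have e : m0 <| q |> l = lm (1 - q%:num) l m0.
      apply: lotteryP => y; rewrite convE lmE; first by ring.
      by case/andP: q01 => *; apply/andP; split; lra.
    have t01 : 0 < (1 - q%:num : R) <= 1 by case/andP: q01 => *; apply/andP; split; lra.
    exists (1 - q%:num); split=> //; last by rewrite -e; apply: npr.
    apply: pr_trans (npr m0a) _; rewrite -[X in pr X _](lmm (1 - q%:num)).
    by apply: (lm_indep _ _ _ t01).1; apply: pr_trans (npr bm0) (npr lb).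
  - have [_ [r [_ r01 _ ra]]] := pr_cont al m0a.
    have t01 : 0 < (r%:num : R) <= 1 by case/andP: r01 => -> /ltW ->.
    have e : l <| r |> m0 = lm r%:num l m0.
      by apply: lotteryP => y; rewrite convE lmE//; case/andP: r01 => *; rewrite !ltW.
    exists r%:num; split=> //; first by rewrite -e; apply: npr.
    apply: pr_trans _ (npr bm0); rewrite -[X in pr _ X](lmm r%:num).
    by apply: (lm_indep _ _ _ t01).1; apply: pr_trans (npr al) (npr m0a).
  - by case: ab; apply: pr_trans (npr lb) (npr al).
have [z [z01 ez]] := between at_ tb.
case/andP: (t01) => t0 _.
have tz : t * ((2 * z - 1) / t) = 2 * z - 1 by field; rewrite gt_eqF.
(* 2z - 1 converts the path parameter to [-1,1], and the division undoes the shrinking. *)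
exists ((2 * z - 1) / t), t; split=> //; rewrite tz.
  by case/andP: z01 => *; rewrite ler_norml; apply/andP; split; lra.
by have -> : lam (2 * z - 1) = path z by congr path; lra.
Qed.

Theorem von_neumann_morgenstern : exists U : Y -> R,
  [/\ forall l l', pr l l' <-> utility U l' <= utility U l,
      utility U a = 1 & utility U b = - 1].
Proof.
pose u l := sval (cid (val_exists l)).
have uP l : exists t, val_at l (u l) t by exact: (svalP (cid (val_exists l))).
have u_uniq l x t : val_at l x t -> u l = x.
  move=> v; have [t' v'] := uP l; apply/eqP; rewrite eq_le.
  by rewrite (val_le v v').1//= (val_le v' v).1.
have uconv p l l' : u (l <| p |> l') = p%:num * u l + (1 - p%:num) * u l'.
  have [t v] := uP l; have [t' v'] := uP l'.
  have [s [[s01 sx e] [_ sx' e']]] := val_common v v'.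
  have ee : lm s (l <| p |> l') m0 = lm s l m0 <| p |> lm s l' m0.
    have s01' : 0 <= s <= 1 by case/andP: s01 => /ltW ->.
    by apply: lotteryP => y; rewrite convE !(lmE _ _ _ s01') !convE; ring.
  have sE : s * (p%:num * u l + (1 - p%:num) * u l') =
      p%:num * (s * u l) + (1 - p%:num) * (s * u l') by ring.
  apply: (u_uniq _ _ s); split=> //; rewrite sE.
    apply: le_trans (ler_normD _ _) _.
    have [p0 p1] : 0 <= p%:num :> R /\ 0 <= 1 - p%:num :> R by rewrite subr_ge0.
    rewrite (normrM p%:num) (normrM (1 - p%:num)) (ger0_norm p0) (ger0_norm p1).
    have := lerD (ler_wpM2l p0 sx) (ler_wpM2l p1 sx').
    by move/le_trans; apply; lra.
  by rewrite ee -lam_conv//; apply: conv_eqv.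
exists (fun y => u (dirac y)).
have uE : u = utility (fun y => u (dirac y)).
  by apply/funext => l; apply: affine_utility.
rewrite -uE; split.
- by move=> l l'; have [t v] := uP l; have [t' v'] := uP l'; apply: val_le v v'.
- apply: (u_uniq _ _ 1); rewrite /val_at ltr01 lexx mulr1 normr1; split=> //.
  by rewrite lm_one -path1 /lam (_ : (1 + 1) / 2 = 1 :> R); [split|lra].
- apply: (u_uniq _ _ 1); rewrite /val_at ltr01 lexx mulrN mulr1 normrN normr1; split=> //.
  by rewrite lm_one -path0 /lam (_ : (1 - 1) / 2 = 0 :> R); [split|lra].
Qed.

End VonNeumannMorgenstern.

(** * From orders on regret vectors to functionals *)

Section ConeRepresentation.
Context {R : realType} {S : finType}.
Implicit Types (x y z : S -> R) (p c d : R).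
Variable Le : (S -> R) -> (S -> R) -> Prop.
Local Notation cst c := (fun _ : S => c).

(** The axioms in terms of losses, [Le x y] meaning that x is at least as good as y: [ro_scale]
    reflects independence, [ro_cont] mixture continuity, [ro_convex] ambiguity aversion, and
    [ro_cst] the comparison of constant acts. *)
Record regret_order : Prop := {
  ro_total : forall x y, nonneg x -> nonneg y -> Le x y \/ Le y x;
  ro_trans : forall x y z, nonneg x -> nonneg y -> nonneg z ->
    Le x y -> Le y z -> Le x z;
  ro_mono : forall x y, nonneg x -> (forall s, x s <= y s) -> Le x y;
  ro_scale : forall c x y, 0 < c ->
    Le x y -> Le (fun s => c * x s) (fun s => c * y s);
  ro_cst : forall c d, 0 <= c -> 0 <= d -> Le (cst c) (cst d) -> c <= d;
  ro_cont : forall x y z, nonneg x -> nonneg y -> nonneg z ->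
    ~ Le y x -> ~ Le z y -> exists q r, [/\ 0 < q < 1, 0 < r < 1,
      ~ Le y (fun s => q * x s + (1 - q) * z s) &
      ~ Le (fun s => r * x s + (1 - r) * z s) y];
  ro_convex : forall p x y, nonneg x -> nonneg y -> 0 < p < 1 ->
    Le x y -> Le y x -> Le (fun s => p * x s + (1 - p) * y s) y
}.

Hypothesis ro : regret_order.

Let c00 : nonneg (cst (0 : R)). Proof. by move=> s. Qed.

Let cst0 c : 0 <= c -> nonneg (cst c). Proof. by move=> c0 s. Qed.

Let nLe x y : nonneg x -> nonneg y -> ~ Le x y -> Le y x.
Proof. by move=> x0 y0; case: (ro_total ro x0 y0). Qed.

Lemma certainty_equivalent x : nonneg x ->
  exists c, [/\ 0 <= c, Le (cst c) x & Le x (cst c)].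
Proof.
move=> x0; have [B B0 xB] := fin_bound x.
have B1 : 0 <= B + 1 by rewrite addr_ge0// ltW.
(* Going beyond the bound B by 1 makes this constant strictly worse than x, as mixture continuity
   requires of its third argument. *)
have xB1 : ~ Le (cst (B + 1)) x.
  move=> h; have xb : Le x (cst B) by apply: (ro_mono ro).
  have := ro_cst ro B1 (ltW B0) (ro_trans ro (cst0 B1) x0 (cst0 (ltW B0)) h xb).
  by lra.
have [|||c [/andP[c0 _] lo hi]] :=
  @crossing R (B + 1) (fun c => Le (cst c) x) (fun c => Le x (cst c)) B1.
- exact: (ro_mono ro).
- move=> c /andP[c0 cB] nhi.
  have {}cB : c < B + 1.
    rewrite lt_neqAle cB andbT; apply/eqP => e; apply: nhi; rewrite e.
    by apply: (ro_mono ro) => // s; rewrite (le_trans (xB s))// lerDl.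
  have [q [_ [/andP[q0 q1] _ h _]]] := ro_cont ro (cst0 c0) x0 (cst0 B1) nhi xB1.
  have cc' : c < q * c + (1 - q) * (B + 1).
    have := mulr_gt0 (_ : 0 < 1 - q) (_ : 0 < B + 1 - c).
    by rewrite !subr_gt0 => /(_ q1 cB); lra.
  have c'0 := le_trans c0 (ltW cc').
  exists (q * c + (1 - q) * (B + 1)); split=> //; last exact: nLe h.
  have := mulr_ge0 (ltW q0) (_ : 0 <= B + 1 - c).
  by rewrite subr_ge0 => /(_ (ltW cB)); lra.
- move=> c /andP[c0 cB] nlo.
  have c_gt0 : 0 < c.
    rewrite lt_neqAle c0 andbT; apply/eqP => e; apply: nlo; rewrite -e.
    exact: (ro_mono ro).
  have [xle0|xgt0] := pselect (Le x (cst 0)).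
    exists 0 => // d /andP[d0 _] dx; apply: (ro_cst ro d0 (lexx _)).
    exact: (ro_trans ro (cst0 d0) x0 c00 dx xle0).
  have [_ [r [_ /andP[r0 r1] _ h]]] :=
    ro_cont ro c00 x0 (cst0 c0) xgt0 nlo.
  have c'0 : 0 <= r * 0 + (1 - r) * c.
    by rewrite mulr0 add0r mulr_ge0// subr_ge0 ltW.
  exists (r * 0 + (1 - r) * c) => [|d /andP[d0 _] dx].
    by have := mulr_gt0 r0 c_gt0; lra.
  rewrite leNgt; apply/negP => c'd; apply: h.
  have c'dL : Le (cst (r * 0 + (1 - r) * c)) (cst d).
    by apply: (ro_mono ro) => // s; exact: ltW.
  exact: (ro_trans ro (cst0 c'0) (cst0 d0) x0 c'dL dx).
by exists c.
Qed.

Theorem regret_order_functional :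
  exists2 Phi, regret_functional Phi &
    forall x y, nonneg x -> nonneg y -> Le x y <-> Phi x <= Phi y.
Proof.
have /choice[Phi PhiP] : forall x, exists c,
    nonneg x -> [/\ 0 <= c, Le (cst c) x & Le x (cst c)].
  move=> x; have [x0|nx0] := pselect (nonneg x); last by exists 0.
  by have [c cP] := certainty_equivalent x0; exists c.
have rep x y : nonneg x -> nonneg y -> Le x y <-> Phi x <= Phi y.
  move=> x0 y0; have [a0 ax xa] := PhiP x x0; have [b0 by_ yb] := PhiP y y0.
  split=> [xy|ab].
    apply: (ro_cst ro a0 b0); apply: (ro_trans ro (cst0 a0) x0 (cst0 b0) ax).
    exact: (ro_trans ro x0 y0 (cst0 b0) xy yb).
  apply: (ro_trans ro x0 (cst0 a0) y0 xa).
  apply: (ro_trans ro (cst0 a0) (cst0 b0) y0 _ by_).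
  by apply: (ro_mono ro).
have uniq x c : nonneg x -> 0 <= c -> Le (cst c) x -> Le x (cst c) -> Phi x = c.
  move=> x0 c0 cx xc; have [a0 ax xa] := PhiP x x0.
  apply/eqP; rewrite eq_le; apply/andP; split; apply: (ro_cst ro) => //.
    exact: (ro_trans ro (cst0 a0) x0 (cst0 c0) ax xc).
  exact: (ro_trans ro (cst0 c0) x0 (cst0 a0) cx xa).
have Phi_cst c : 0 <= c -> Phi (cst c) = c.
  by move=> c0; apply: uniq => //; apply: (ro_mono ro).
have mono x y : nonneg x -> (forall s, x s <= y s) -> Phi x <= Phi y.
  move=> x0 xy; apply/rep => //; last exact: (ro_mono ro).
  by move=> s; apply: le_trans (xy s).
have scale c x : 0 <= c -> nonneg x -> Phi (fun s => c * x s) = c * Phi x.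
  move=> + x0; rewrite le_eqVlt => /predU1P[<-|c0].
    rewrite mul0r (_ : (fun s => 0 * x s) = cst 0) ?Phi_cst//.
    by apply/funext => s; rewrite mul0r.
  have [a0 ax xa] := PhiP x x0; apply: uniq.
  - by move=> s; rewrite mulr_ge0// ltW.
  - by rewrite mulr_ge0// ltW.
  - exact: (ro_scale ro c0 ax).
  - exact: (ro_scale ro c0 xa).
(* Scaled to value 1 the two vectors are indifferent, so their mixtures have value at most 1. The
   weight a/(a + b) makes the mixture equal to (x + y)/(a + b). *)
have subadd_pos x y : nonneg x -> nonneg y -> 0 < Phi x -> 0 < Phi y ->
    Phi (fun s => x s + y s) <= Phi x + Phi y.
  move=> x0 y0; set a := Phi x; set b := Phi y => a0 b0.
  have ab0 : 0 < a + b by rewrite addr_gt0.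
  pose x' s := a^-1 * x s; pose y' s := b^-1 * y s.
  have x'0 : nonneg x' by move=> s; rewrite mulr_ge0// invr_ge0 ltW.
  have y'0 : nonneg y' by move=> s; rewrite mulr_ge0// invr_ge0 ltW.
  have Px' : Phi x' = 1 by rewrite scale ?invr_ge0 ?(ltW a0)// mulVf// gt_eqF.
  have Py' : Phi y' = 1 by rewrite scale ?invr_ge0 ?(ltW b0)// mulVf// gt_eqF.
  pose p := a / (a + b).
  have p01 : 0 < p < 1 by rewrite divr_gt0//= ltr_pdivrMr// mul1r ltrDl.
  have xy' : Le x' y' by apply/rep; rewrite // Px' Py'.
  have yx' : Le y' x' by apply/rep; rewrite // Px' Py'.
  have := ro_convex ro x'0 y'0 p01 xy' yx'.
  have -> : (fun s => p * x' s + (1 - p) * y' s) = (fun s => (a + b)^-1 * (x s + y s)).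
    by apply/funext => s; rewrite /p /x' /y'; field; rewrite !gt_eqF.
  have xy0 : nonneg (fun s => x s + y s) by move=> s; rewrite addr_ge0.
  have iab0 : 0 <= (a + b)^-1 by rewrite invr_ge0 ltW.
  have sxy0 : nonneg (fun s => (a + b)^-1 * (x s + y s)).
    by move=> s; rewrite mulr_ge0.
  move/(rep _ _ sxy0 y'0); rewrite Py' (scale _ _ iab0 xy0).
  by rewrite ler_pdivrMl// mulr1.
(* Mixture continuity towards the constant 1 makes Phi upper semicontinuous at
   its zeros, to which the normalisation in subadd_pos does not apply. *)
have approx x e : nonneg x -> 0 < e -> exists x',
    [/\ nonneg x', forall s, x s <= x' s, 0 < Phi x' & Phi x' <= Phi x + e].
  move=> x0 e0; have [Px0 _ _] := PhiP x x0.
  have [Pxgt0|] := ltP 0 (Phi x); first by exists x; rewrite Pxgt0 lerDl (ltW e0).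
  move=> Pxle0; have {Px0 Pxle0} Px : Phi x = 0 by apply/eqP; rewrite eq_le Pxle0.
  (* From 1 - q <= [Phi w] < c <= 1/2 it follows that q exceeds 1/2, so dividing w by q at most
     doubles its value, which stays below 2c <= e. *)
  pose c := Num.min (e / 2) (1 / 2).
  have c0 : 0 < c by rewrite lt_min; apply/andP; split; lra.
  have ce : c <= e / 2 by rewrite ge_min lexx.
  have c2 : c <= 1 / 2 by rewrite ge_min lexx orbT.
  have xc : ~ Le (cst c) x.
    by move/(rep _ _ (cst0 (ltW c0)) x0); rewrite Phi_cst ?(ltW c0)// Px leNgt c0.
  have c1 : ~ Le (cst 1) (cst c) by move/(ro_cst ro ler01 (ltW c0)); lra.
  have [q [_ [/andP[q0 q1] _ h _]]] :=
    ro_cont ro x0 (cst0 (ltW c0)) (cst0 ler01) xc c1.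
  pose w s := q * x s + (1 - q) * 1.
  have {}h : ~ Le (cst c) w by [].
  have w0 : nonneg w.
    by move=> s; rewrite /w addr_ge0// mulr_ge0// ?subr_ge0 ltW.
  have Pw : Phi w < c.
    rewrite ltNge; apply/negP => cw; apply: h.
    by apply/(rep _ _ (cst0 (ltW c0)) w0); rewrite Phi_cst ?(ltW c0).
  have qPw : 1 - q <= Phi w.
    rewrite -[leLHS]Phi_cst ?subr_ge0 ?(ltW q1)//; apply: mono => s.
      by rewrite subr_ge0 ltW.
    by rewrite /w mulr1 lerDr mulr_ge0// ltW.
  exists (fun s => q^-1 * w s); rewrite scale ?invr_ge0 ?(ltW q0)// Px add0r.
  split=> [s|s||].
  - by rewrite mulr_ge0 ?invr_ge0 ?(ltW q0).
  - by rewrite ler_pdivlMl// /w mulr1 lerDl subr_ge0 ltW.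
  - by rewrite mulr_gt0 ?invr_gt0// (lt_le_trans _ qPw)// subr_gt0.
  - rewrite ler_pdivrMl//.
    have q2 : 0 <= q - 1 / 2 by lra.
    by have := mulr_ge0 q2 (ltW e0); lra.
exists Phi => //; split=> //.
- by move=> c x y c0 x0 yE; rewrite -scale//; congr Phi; apply/funext.
- move=> x y z x0 y0 z0 zle; apply/ler_addgt0Pr => e e0.
  have e2 : 0 < e / 2 by lra.
  have [x' [x'0 xx' Px' Px'e]] := approx x _ x0 e2.
  have [y' [y'0 yy' Py' Py'e]] := approx y _ y0 e2.
  apply: (@le_trans _ _ (Phi (fun s => x' s + y' s))).
    by apply: mono => // s; apply: le_trans (zle s) (lerD (xx' s) (yy' s)).
  by apply: le_trans (subadd_pos _ _ x'0 y'0 Px' Py') _; lra.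
Qed.

End ConeRepresentation.

(** * Completeness of the axioms *)

Section AffineUtility.
Context {R : realType} {S : finType} {Y : choiceType}.
Implicit Types (l a b : lottery R Y) (M : set (act R S Y)) (f : act R S Y).
Variables U U' : Y -> R.

Definition lottery_of_utility a b (t : R) : lottery R Y :=
  a <| clamp ((1 + t) / 2) |> b.

Lemma lottery_of_utilityE a b t : utility U a = 1 -> utility U b = - 1 ->
  `|t| <= 1 -> utility U (lottery_of_utility a b t) = t.
Proof.
move=> Ua Ub; rewrite ler_norml => /andP[t1 t2].
rewrite utility_conv clampE ?Ua ?Ub; first by field.
by apply/andP; split; lra.
Qed.

Lemma utility_between l l' t : utility U l <= t <= utility U l' ->
  exists a, utility U a = t.
Proof.
set v := utility U l; set v' := utility U l' => /andP[vt tv'].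
have [vv'|v'v] := ltP v v'; last first.
  by exists l; apply/eqP; rewrite eq_le vt (le_trans tv').
have v0 : 0 < v' - v by rewrite subr_gt0.
exists (l' <| clamp ((t - v) / (v' - v)) |> l).
rewrite utility_conv clampE; first by rewrite -/v -/v'; field; rewrite gt_eqF.
apply/andP; split; first by rewrite divr_ge0 ?subr_ge0 ?(ltW v0)// ltW.
by rewrite ler_pdivrMr// mul1r lerD2r.
Qed.

Lemma utility_affine (c d : R) l : (forall y, U' y = c * U y + d) ->
  utility U' l = c * utility U l + d.
Proof.
move=> U'E; rewrite /utility -[d]mulr1 -(lottery_sum l) !mulr_sumr -big_split/=.
by apply: eq_bigr => y _; rewrite U'E; ring.
Qed.

Lemma menu_sup_affine (c d : R) M f s : 0 < c -> (forall y, U' y = c * U y + d) ->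
  utility_bounded U M -> M f ->
  utility_bounded U' M /\ state_regret U' M f s = c * state_regret U M f s.
Proof.
move=> c0 U'E bM Mf.
have bM' : utility_bounded U' M.
  move=> s'; have [B MB] := bM s'; exists (c * B + d) => _ [g Mg <-].
  rewrite (utility_affine _ U'E) lerD2r ler_pM2l//.
  by apply: MB; exists g.
split=> //; rewrite /state_regret (utility_affine _ U'E).
suff -> : sup (menu_utilities U' M s) = c * sup (menu_utilities U M s) + d by ring.
apply/eqP; rewrite eq_le; apply/andP; split.
  apply: sup_utility_le => [|g Mg]; first by exists f.
  by rewrite (utility_affine _ U'E) lerD2r ler_pM2l// le_sup_utility.
rewrite -lerBrDr -ler_pdivlMl//; apply: sup_utility_le => [|g Mg].
  by exists f.
by rewrite ler_pdivlMl// lerBrDr -(utility_affine _ U'E) le_sup_utility.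
Qed.

Lemma represents_affine (menus : set (set (act R S Y))) pref P (c d : R) : 0 < c ->
  (forall y, U' y = c * U y + d) -> weighted_set P ->
  represents U menus pref P -> represents U' menus pref P.
Proof.
move=> c0 U'E wP rep M mM; have [bM prefE] := rep M mM.
split=> [s|f g Mf Mg].
  have [[f Mf]|M0] := pselect (M !=set0).
    exact: (menu_sup_affine s c0 U'E bM Mf).1.
  by exists 0 => t [f Mf _]; case: M0; exists f.
have regE h : M h ->
    weighted_sup P (state_regret U' M h) = c * weighted_sup P (state_regret U M h).
  move=> Mh; apply: (rf_scale (weighted_sup_functional wP)) => [|s|s].
  - exact: ltW.
  - exact: regret_ge0.
  - exact: (menu_sup_affine s c0 U'E bM Mh).2.
by rewrite (prefE f g Mf Mg) !mwerE !regE// ler_pM2l.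
Qed.

(** The constants c and d are read off at a and b, which settles the segment between them. Any prize
    is brought to that segment by mixing with the midpoint, and solving for its utility gives the
    same formula. *)
Lemma same_order_affine a b :
  (forall l l', utility U l' <= utility U l <-> utility U' l' <= utility U' l) ->
  utility U a = 1 -> utility U b = - 1 ->
  exists c d : R, 0 < c /\ forall y, U' y = c * U y + d.
Proof.
move=> UU' Ua Ub.
pose c := (utility U' a - utility U' b) / 2; pose d := (utility U' a + utility U' b) / 2.
have c0 : 0 < c.
  rewrite divr_gt0// subr_gt0 ltNge; apply/negP => /UU'; rewrite Ua Ub.
  lra.
exists c, d; split=> // y.
pose lam t := lottery_of_utility a b t.
have lamE t : `|t| <= 1 -> utility U (lam t) = t.
  exact: lottery_of_utilityE.
have lamE' t : `|t| <= 1 -> utility U' (lam t) = c * t + d.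
  rewrite ler_norml => /andP[t1 t2]; rewrite utility_conv clampE.
    by rewrite /c /d; field.
  by apply/andP; split; lra.
have n0 : `|0 : R| <= 1 by rewrite normr0.
(* Small enough to bring the utility of y into [-1,1], and well defined when that utility is 0. *)
pose t := (1 + `|U y|)^-1.
have y0 : 0 < 1 + `|U y| by rewrite ltr_pwDl.
have t0 : 0 < t by rewrite invr_gt0.
have t01 : 0 <= t <= 1 by rewrite ltW//= invf_le1// lerDl.
have ty : `|t * U y| <= 1.
  by rewrite normrM gtr0_norm// ler_pdivrMl// mulr1 lerDr.
pose l := dirac y <| clamp t |> lam 0.
have ul : utility U l = utility U (lam (t * U y)).
  by rewrite utility_conv utility_dirac clampE// !lamE// mulr0 addr0.
have : utility U' l = utility U' (lam (t * U y)).
  by apply/eqP; rewrite eq_le; apply/andP; split; apply/UU'; rewrite ul.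
rewrite utility_conv utility_dirac clampE// !lamE'// mulr0 add0r => e.
by apply: (mulfI (lt0r_neq0 t0)); lra.
Qed.

End AffineUtility.

Section Family.
Context {R : realType} {S : finType} {Y : choiceType}.
Local Notation act := (act R S Y).
Local Notation lottery := (lottery R Y).
Implicit Types (M N : set act) (f g h k : act) (l a b : lottery) (p : {i01 R}).
Implicit Types (x y z : S -> R) (t e : R).
Variables (menus : set (set act)) (pref : set act -> act -> act -> Prop).
Hypothesis mmenus : menu_system menus.
Hypothesis ax : axioms1_9 menus pref.

Let menu1 f : menus [set f]. Proof. exact: menu_set1. Qed.

Let menuU M N : menus M -> menus N -> menus (M `|` N).
Proof. exact: menu_setU. Qed.

Lemma const_prefE M l l' : menus M -> M (const_act l) -> M (const_act l') ->
  pref M (const_act l) (const_act l') <-> const_pref pref l l'.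
Proof.
move=> mM Ml Ml'; apply: (menu_independence ax) => //; first exact: menuU.
- by left.
- by right.
Qed.

Lemma const_pref_total l l' : const_pref pref l l' \/ const_pref pref l' l.
Proof.
have m2 : menus [set const_act l; const_act l'] by apply: menuU.
rewrite -!(const_prefE m2); [|by right|by left|by left|by right].
by apply: (completeness ax) => //; [left|right].
Qed.

Lemma const_pref_trans l l' l'' :
  const_pref pref l l' -> const_pref pref l' l'' -> const_pref pref l l''.
Proof.
pose M : set act := [set const_act l; const_act l'; const_act l''].
have mM : menus M by apply: menuU => //; apply: menuU.
have [Ml Ml' Ml''] : [/\ M (const_act l), M (const_act l') & M (const_act l'')].
  by split; [left; left|left; right|right].
by rewrite -!(const_prefE mM)//; apply: (transitivity ax).
Qed.

Lemma const_pref_indep p l l' a : 0 < p%:num < 1 ->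
  const_pref pref l l' <-> const_pref pref (l <| p |> a) (l' <| p |> a).
Proof.
move=> p01; pose M : set act := [set const_act l; const_act l'].
have mM : menus M by apply: menuU.
have Ml : M (const_act l) by left.
have Ml' : M (const_act l') by right.
apply: iff_trans (independence ax (const_act a) mM Ml Ml' p01) _.
apply: (@const_prefE (mix_menu p M (const_act a)) (l <| p |> a) (l' <| p |> a)).
- exact: menu_mix.
- by exists (const_act l).
- by exists (const_act l').
Qed.

Lemma const_pref_cont l l' l'' :
  ~ const_pref pref l' l -> ~ const_pref pref l'' l' ->
  exists q r : {i01 R}, [/\ 0 < q%:num < 1, 0 < r%:num < 1,
    ~ const_pref pref l' (l <| q |> l'') & ~ const_pref pref (l <| r |> l'') l'].
Proof.
pose M : set act := [set const_act l; const_act l'; const_act l''].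
have mM : menus M by apply: menuU => //; apply: menuU.
have [Ml Ml' Ml''] : [/\ M (const_act l), M (const_act l') & M (const_act l'')].
  by split; [left; left|left; right|right].
have st a b : M (const_act a) -> M (const_act b) -> ~ const_pref pref b a ->
    strict pref M (const_act a) (const_act b).
  move=> Ma Mb ba; rewrite /strict !const_prefE//; split=> //.
  by case: (const_pref_total a b).
move=> /(st _ _ Ml Ml') h1 /(st _ _ Ml' Ml'') h2.
have [q [r [q01 r01 [_ hq] [_ hr]]]] := mixture_continuity ax mM Ml Ml' Ml'' h1 h2.
exists q, r; split=> // [h|h]; [apply: hq|apply: hr].
  apply/(@const_prefE _ l' (l <| q |> l'')) => //; first exact: menuU.
  - by left.
  - by right.
apply/(@const_prefE _ (l <| r |> l'') l') => //; first exact: menuU.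
- by right.
- by left.
Qed.

Lemma const_pref_nontrivial : exists a b, ~ const_pref pref b a.
Proof.
have [M [f [g [mM Mf Mg [fg gf]]]]] := nontriviality ax.
apply: contrapT => h; apply: gf; apply: (monotonicity ax) => // s.
by apply: contrapT => h'; apply: h; exists (f s), (g s).
Qed.

Lemma state_exists : exists s : S, True.
Proof.
have [M [f [g [_ _ _ [fg gf]]]]] := nontriviality ax.
apply: contrapT => noS; apply: gf.
have e : f = g by apply/funext => s; case: noS; exists s.
by rewrite e in fg *.
Qed.

Lemma utility_exists : exists (U : Y -> R) a b,
  [/\ forall l l', const_pref pref l l' <-> utility U l' <= utility U l,
      utility U a = 1 & utility U b = - 1].
Proof.
have [a [b ab]] := const_pref_nontrivial.
have [U [UP Ua Ub]] := von_neumann_morgenstern const_pref_total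
  const_pref_trans const_pref_indep const_pref_cont ab.
by exists U, a, b.
Qed.

(** * From preferences in menus to an order on regret vectors *)

Section Reduction.
Variables (U : Y -> R) (a b : lottery).
Hypothesis UP : forall l l', const_pref pref l l' <-> utility U l' <= utility U l.
Hypotheses (Ua : utility U a = 1) (Ub : utility U b = - 1).
Local Notation u := (utility U).
Local Notation lam := (lottery_of_utility a b).

Definition dominates k M := forall h s, M h -> u (h s) <= u (k s).

Lemma pref_mono M f g : menus M -> M f -> M g ->
  (forall s, u (g s) <= u (f s)) -> pref M f g.
Proof. by move=> mM Mf Mg fg; apply: (monotonicity ax) => // s; apply/UP. Qed.

Lemma pref_utility M f g f' g' : menus M -> M f -> M g -> M f' -> M g' ->
  (forall s, u (f s) = u (f' s)) -> (forall s, u (g s) = u (g' s)) ->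
  pref M f g -> pref M f' g'.
Proof.
move=> mM Mf Mg Mf' Mg' ff' gg' fg.
have f'f : pref M f' f by apply: pref_mono => // s; rewrite ff'.
have gg'P : pref M g g' by apply: pref_mono => // s; rewrite gg'.
by apply: (transitivity ax) f'f _ => //; apply: (transitivity ax) fg gg'P.
Qed.

(** Next to k no other act of M is strictly optimal in any state, so all of M can be added to, or
    removed from, the three-element menu. *)
Lemma pref_restrict M k f g : menus M -> M k -> M f -> M g -> dominates k M ->
  pref M f g <-> pref [set k; f; g] f g.
Proof.
move=> mM Mk Mf Mg kM; have -> : M = [set k; f; g] `|` M.
  apply/seteqP; split=> [h Mh|h [[[->|->]|->]|]//]; by right.
apply: iff_sym; apply: (never_strictly_optimal_independence ax) => //.
- by apply: menuU => //; apply: menuU.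
- by left; right.
- by right.
- by move=> h Mh s; exists k; [left; left|apply/UP; apply: kM].
Qed.

(** The union of the menus is dominated by both k and k', so each comparison moves there; within one
    menu, acts of equal utility are interchangeable by monotonicity. *)
Lemma pref_equiv M k f g M' k' f' g' :
  menus M -> M k -> M f -> M g -> dominates k M ->
  menus M' -> M' k' -> M' f' -> M' g' -> dominates k' M' ->
  (forall s, u (k s) = u (k' s)) -> (forall s, u (f s) = u (f' s)) ->
  (forall s, u (g s) = u (g' s)) -> pref M f g -> pref M' f' g'.
Proof.
move=> mM Mk Mf Mg kM mM' Mk' Mf' Mg' kM' kk' ff' gg'.
have mN : menus (M `|` M') by apply: menuU.
have kN : dominates k (M `|` M').
  by move=> h s [/kM|/kM']; [apply|rewrite kk'; apply].
have k'N : dominates k' (M `|` M') by move=> h s /kN; rewrite -kk'; apply.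
rewrite (pref_restrict mM Mk Mf Mg kM).
rewrite (pref_restrict mM' Mk' Mf' Mg' kM').
rewrite -(@pref_restrict (M `|` M') k f g)//; try by left.
rewrite -(@pref_restrict (M `|` M') k' f' g')//; try by right.
apply: pref_utility => //; by [left|right].
Qed.

(** In a menu dominated by the loss act of 0 its regret vector is x, provided x lies in the unit
    box. *)
Definition loss_act x : act := fun s => lam (- x s).

Definition unit_box x := forall s, 0 <= x s <= 1.

Lemma utility_loss_act x s : unit_box x -> u (loss_act x s) = - x s.
Proof.
move=> /(_ s)/andP[x0 x1]; rewrite (lottery_of_utilityE Ua Ub)//.
by rewrite normrN ger0_norm.
Qed.

Definition loss_menu x y := [set loss_act (fun=> 0); loss_act x; loss_act y].

Definition loss_pref x y := pref (loss_menu x y) (loss_act x) (loss_act y).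

Lemma box0 : unit_box (fun=> 0).
Proof. by move=> s; rewrite lexx ler01. Qed.

Lemma loss_menu_menus x y : menus (loss_menu x y).
Proof. by apply: menuU => //; apply: menuU. Qed.

Lemma loss_menu_dominates x y : unit_box x -> unit_box y ->
  dominates (loss_act (fun=> 0)) (loss_menu x y).
Proof.
move=> bx by_ h s; rewrite (utility_loss_act _ box0) oppr0.
case=> [[->|->]|->]; rewrite utility_loss_act ?oppr0 ?oppr_le0//.
- exact: box0.
- by case/andP: (bx s).
- by case/andP: (by_ s).
Qed.

(* Mixing with an act that offsets the utility of k makes the dominating act
   constant. *)
Lemma pref_scaled M k f g : menus M -> M k -> M f -> M g -> dominates k M ->
  exists2 e0, 0 < e0 & forall e, 0 < e <= e0 ->
    pref M f g <-> loss_pref (fun s => e * (u (k s) - u (f s)))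
                             (fun s => e * (u (k s) - u (g s))).
Proof.
move=> mM Mk Mf Mg kM.
have [B B0 xB] := fin_bound
  (fun s => `|u (k s)| + (u (k s) - u (f s)) + (u (k s) - u (g s))).
have f0 s : 0 <= u (k s) - u (f s) by rewrite subr_ge0 kM.
have g0 s : 0 <= u (k s) - u (g s) by rewrite subr_ge0 kM.
(* This gives e(1 + B) <= 1/2: both scaled loss vectors fit into the unit box, and e|u(k)| <= 1 - e,
   so the offsetting utility is available. *)
exists (1 / (2 * (1 + B))) => [|e /andP[e0]].
  by rewrite divr_gt0// mulr_gt0// addr_gt0.
rewrite ler_pdivlMr; last by rewrite mulr_gt0// addr_gt0.
move=> eB; have eB0 := mulr_gt0 e0 B0.
have e1 : 0 < e < 1 by apply/andP; split; lra.
have eu s : e * (`|u (k s)| + (u (k s) - u (f s)) + (u (k s) - u (g s))) <= e * B.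
  by rewrite ler_pM2l// xB.
have ek0 s : 0 <= e * `|u (k s)| by rewrite mulr_ge0// ltW.
have ef0 s : 0 <= e * (u (k s) - u (f s)) by rewrite mulr_ge0// ltW.
have eg0 s : 0 <= e * (u (k s) - u (g s)) by rewrite mulr_ge0// ltW.
set x := (fun s => e * (u (k s) - u (f s))).
set y := (fun s => e * (u (k s) - u (g s))).
have bx : unit_box x.
  move=> s; rewrite ef0/= /x.
  by have := eu s; have := ek0 s; have := ef0 s; have := eg0 s; lra.
have by_ : unit_box y.
  move=> s; rewrite eg0/= /y.
  by have := eu s; have := ek0 s; have := ef0 s; have := eg0 s; lra.
(* Chosen so that mixing k with h at weight e has utility 0 in every state. *)
pose h : act := fun s => lam (- (e * u (k s)) / (1 - e)).
have uh s : (1 - e) * u (h s) = - (e * u (k s)).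
  have e1' : 0 < 1 - e by lra.
  rewrite (lottery_of_utilityE Ua Ub); first by rewrite mulrC divfK// gt_eqF.
  rewrite normrM normfV normrN normrM (gtr0_norm e0) (gtr0_norm e1').
  rewrite ler_pdivrMr//.
  by have := eu s; have := ek0 s; have := ef0 s; have := eg0 s; lra.
have ce : (clamp e)%:num = e by rewrite clampE_open.
have umix f' s : u (mix_act (clamp e) f' h s) = e * u (f' s) - e * u (k s).
  by rewrite utility_mix_act ce uh.
have mN : menus (mix_menu (clamp e) M h) by apply: menu_mix => //; rewrite ce.
have kN : dominates (mix_act (clamp e) k h) (mix_menu (clamp e) M h).
  by move=> _ s [f' Mf' <-]; rewrite !umix lerD2r ler_pM2l// kM.
have [Nk Nf Ng] : [/\ mix_menu (clamp e) M h (mix_act (clamp e) k h),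
    mix_menu (clamp e) M h (mix_act (clamp e) f h)
    & mix_menu (clamp e) M h (mix_act (clamp e) g h)].
  by split; [exists k|exists f|exists g].
have p01 : 0 < (clamp e)%:num < 1 by rewrite ce.
rewrite (independence ax h mM Mf Mg p01).
have uk s : u (mix_act (clamp e) k h s) = u (loss_act (fun=> 0) s).
  by rewrite umix (utility_loss_act _ box0); lra.
have uf s : u (mix_act (clamp e) f h s) = u (loss_act x s).
  by rewrite umix (utility_loss_act _ bx) /x; lra.
have ug s : u (mix_act (clamp e) g h s) = u (loss_act y s).
  by rewrite umix (utility_loss_act _ by_) /y; lra.
have [L0 Lx Ly] : [/\ loss_menu x y (loss_act (fun=> 0)),
    loss_menu x y (loss_act x) & loss_menu x y (loss_act y)].
  by split; [left; left|left; right|right].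
have mL := loss_menu_menus x y; have dL := loss_menu_dominates bx by_.
split; first by apply: (pref_equiv mN Nk Nf Ng kN mL L0 Lx Ly dL).
by apply: (pref_equiv mL L0 Lx Ly dL mN Nk Nf Ng kN).
Qed.

(* Shrinking both vectors brings them into the unit box, which extends
   loss_pref to all nonnegative vectors; by independence the factor is
   irrelevant. *)
Definition regret_pref x y := exists2 e0, 0 < e0 & forall e, 0 < e <= e0 ->
  loss_pref (fun s => e * x s) (fun s => e * y s).

Lemma regret_pref_scale t x y : 0 < t -> regret_pref x y ->
  regret_pref (fun s => t * x s) (fun s => t * y s).
Proof.
move=> t0 [e0 e00 he]; exists (e0 / t) => [|e /andP[e_gt0 ee0]].
  exact: divr_gt0.
have -> : (fun s => e * (t * x s)) = (fun s => (e * t) * x s).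
  by apply/funext => s; rewrite mulrA.
have -> : (fun s => e * (t * y s)) = (fun s => (e * t) * y s).
  by apply/funext => s; rewrite mulrA.
by apply: he; rewrite mulr_gt0//= -ler_pdivlMr.
Qed.

Lemma pref_regret_pref t M k f g x y : 0 < t ->
  menus M -> M k -> M f -> M g -> dominates k M ->
  (forall s, u (k s) - u (f s) = t * x s) ->
  (forall s, u (k s) - u (g s) = t * y s) -> pref M f g <-> regret_pref x y.
Proof.
move=> t0 mM Mk Mf Mg kM fx gy; have [e0 e00 he] := pref_scaled mM Mk Mf Mg kM.
have hE : pref M f g <-> regret_pref (fun s => t * x s) (fun s => t * y s).
  have fE e : (fun s => e * (u (k s) - u (f s))) = (fun s => e * (t * x s)).
    by apply/funext => s; rewrite fx.
  have gE e : (fun s => e * (u (k s) - u (g s))) = (fun s => e * (t * y s)).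
    by apply/funext => s; rewrite gy.
  split=> [fg|[e1 e10 he1]].
    by exists e0 => // e /he; rewrite fE gE => <-.
  (* A single factor small enough for both sides decides, because the preference does not depend on
     it. *)
  have ep : 0 < Num.min e0 e1 by rewrite lt_min e00.
  apply/(he (Num.min e0 e1)); first by rewrite ep ge_min lexx.
  by rewrite fE gE; apply: he1; rewrite ep ge_min lexx orbT.
rewrite hE; split; last exact: regret_pref_scale.
move/(@regret_pref_scale t^-1); rewrite invr_gt0 => /(_ t0).
rewrite (_ : (fun s => _) = x); last by apply/funext => s; rewrite mulKf// gt_eqF.
by rewrite (_ : (fun s => _) = y)//; apply/funext => s; rewrite mulKf// gt_eqF.
Qed.

Lemma loss_box x y z : nonneg x -> nonneg y -> nonneg z -> exists2 e, 0 < e &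
  [/\ unit_box (fun s => e * x s), unit_box (fun s => e * y s)
    & unit_box (fun s => e * z s)].
Proof.
move=> x0 y0 z0; have [B B0 xB] := fin_bound (fun s => x s + y s + z s).
exists B^-1; first by rewrite invr_gt0.
split=> s; apply/andP; split; rewrite ?mulr_ge0 ?invr_ge0 ?(ltW B0)//;
  rewrite ler_pdivrMl// mulr1; apply: le_trans (xB s);
  by have := x0 s; have := y0 s; have := z0 s; lra.
Qed.

Lemma loss_menu3 x y z : unit_box x -> unit_box y -> unit_box z ->
  exists M, [/\ menus M, M (loss_act (fun=> 0)), dominates (loss_act (fun=> 0)) M
    & [/\ M (loss_act x), M (loss_act y) & M (loss_act z)]].
Proof.
move=> bx by_ bz; exists (loss_menu x y `|` loss_menu y z).
split; [|by left; left; left| |].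
- by apply: menuU; apply: loss_menu_menus.
- by move=> h s [] /(loss_menu_dominates _ _); apply.
- by split; [left; left; right|left; right|right; right].
Qed.

Lemma pref_loss e M f g x y : 0 < e -> menus M -> M (loss_act (fun=> 0)) ->
  dominates (loss_act (fun=> 0)) M -> M f -> M g ->
  (forall s, u (f s) = - (e * x s)) -> (forall s, u (g s) = - (e * y s)) ->
  pref M f g <-> regret_pref x y.
Proof.
move=> e0 mM M0 dM Mf Mg fx gy.
by apply: (pref_regret_pref e0 mM M0 Mf Mg dM) => s;
  rewrite (utility_loss_act _ box0) ?fx ?gy opprK oppr0 add0r.
Qed.

(** Each field is an axiom read in a menu of loss acts, after one factor has brought all vectors
    into the unit box. *)
Lemma regret_pref_order : regret_order regret_pref.
Proof.
split.
- move=> x y x0 y0; have [e e0 [bx by_ _]] := loss_box x0 y0 x0.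
  have [M [mM M0 dM [Mx My _]]] := loss_menu3 bx by_ bx.
  have ux s := utility_loss_act s bx; have uy s := utility_loss_act s by_.
  rewrite -(pref_loss e0 mM M0 dM Mx My)// -(pref_loss e0 mM M0 dM My Mx)//.
  exact: (completeness ax).
- move=> x y z x0 y0 z0; have [e e0 [bx by_ bz]] := loss_box x0 y0 z0.
  have [M [mM M0 dM [Mx My Mz]]] := loss_menu3 bx by_ bz.
  have ux s := utility_loss_act s bx; have uy s := utility_loss_act s by_.
  have uz s := utility_loss_act s bz.
  rewrite -(pref_loss e0 mM M0 dM Mx My)// -(pref_loss e0 mM M0 dM My Mz)//.
  rewrite -(pref_loss e0 mM M0 dM Mx Mz)//.
  exact: (transitivity ax).
- move=> x y x0 xy; have y0 s : 0 <= y s by apply: le_trans (xy s).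
  have [e e0 [bx by_ _]] := loss_box x0 y0 x0.
  have [M [mM M0 dM [Mx My _]]] := loss_menu3 bx by_ bx.
  have ux s := utility_loss_act s bx; have uy s := utility_loss_act s by_.
  rewrite -(pref_loss e0 mM M0 dM Mx My)//.
  by apply: pref_mono => // s; rewrite ux uy lerN2 ler_pM2l.
- by move=> c x y; apply: regret_pref_scale.
- move=> c d c0 d0.
  have [e e0 [bc bd _]] := @loss_box (fun=> c) (fun=> d) (fun=> c)
    (fun=> c0) (fun=> d0) (fun=> c0).
  have [M [mM M0 dM [Mc Md _]]] := loss_menu3 bc bd bc.
  have uc s := utility_loss_act s bc; have ud s := utility_loss_act s bd.
  rewrite -(pref_loss e0 mM M0 dM Mc Md)//.
  move/(const_prefE mM (l := lam (- (e * c)))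
                       (l' := lam (- (e * d))) Mc Md).
  have [s _] := state_exists.
  by move/UP; rewrite [X in X <= _](ud s) [X in _ <= X](uc s) => ?;
    rewrite -(ler_pM2l e0) -lerN2.
- move=> x y z x0 y0 z0; have [e e0 [bx by_ bz]] := loss_box x0 y0 z0.
  have [M [mM M0 dM [Mx My Mz]]] := loss_menu3 bx by_ bz.
  have ux s := utility_loss_act s bx; have uy s := utility_loss_act s by_.
  have uz s := utility_loss_act s bz.
  rewrite -{1}(pref_loss e0 mM M0 dM My Mx)// -{1}(pref_loss e0 mM M0 dM Mz My)//.
  move=> nyx nzy.
  have st f g : M f -> M g -> ~ pref M g f -> strict pref M f g.
    by move=> Mf Mg gf; split=> //; case: (completeness ax mM Mf Mg).
  have [q [r [q01 r01 [_ hq] [_ hr]]]] :=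
    mixture_continuity ax mM Mx My Mz (st _ _ Mx My nyx) (st _ _ My Mz nzy).
  pose w p := mix_act p (loss_act (fun s => e * x s)) (loss_act (fun s => e * z s)).
  have uw p s : u (w p s) = - (e * (p%:num * x s + (1 - p%:num) * z s)).
    by rewrite utility_mix_act ux uz; ring.
  have mw p : menus (M `|` [set w p]) by apply: menuU.
  (* The zero-loss act must still dominate after the mixture is adjoined, so that the enlarged menu
     also reduces to regret vectors. *)
  have dw p : dominates (loss_act (fun=> 0)) (M `|` [set w p]).
    move=> h s [/dM|->]; first exact.
    rewrite uw (utility_loss_act _ box0) lerN2 mulr_ge0 ?(ltW e0)//.
    by rewrite addr_ge0// mulr_ge0//.
  exists q%:num, r%:num; split=> // h.
    apply: hq; apply/(pref_loss e0 (mw q) _ (dw q) _ _ uy (uw q)) => //; by [left|right].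
  apply: hr; apply/(pref_loss e0 (mw r) _ (dw r) _ _ (uw r) uy) => //; by [left|right].
- move=> p x y x0 y0 p01; have [e e0 [bx by_ _]] := loss_box x0 y0 x0.
  have [M [mM M0 dM [Mx My _]]] := loss_menu3 bx by_ bx.
  have ux s := utility_loss_act s bx; have uy s := utility_loss_act s by_.
  rewrite -{1}(pref_loss e0 mM M0 dM Mx My)// -{1}(pref_loss e0 mM M0 dM My Mx)//.
  move=> xy yx; have pE : (clamp p)%:num = p by rewrite clampE_open.
  pose w := mix_act (clamp p) (loss_act (fun s => e * x s)) (loss_act (fun s => e * y s)).
  have uw s : u (w s) = - (e * (p * x s + (1 - p) * y s)).
    by rewrite utility_mix_act ux uy pE; ring.
  have mw : menus (M `|` [set w]) by apply: menuU.
  have dw : dominates (loss_act (fun=> 0)) (M `|` [set w]).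
    move=> h s [/dM|->]; first exact.
    rewrite uw (utility_loss_act _ box0) lerN2 mulr_ge0 ?(ltW e0)//.
    by case/andP: p01 => p0 p1; rewrite addr_ge0// mulr_ge0// ?subr_ge0 ltW.
  apply/(pref_loss e0 mw _ dw _ _ uw uy); [by left|by right|by left|].
  by apply: (ambiguity_aversion ax) => //; rewrite pE.
Qed.

(** * Representation, maximality and uniqueness *)

Section Representation.
Variable Phi : (S -> R) -> R.
Hypothesis rPhi : regret_functional Phi.
Hypothesis PhiP : forall x y, nonneg x -> nonneg y ->
  regret_pref x y <-> Phi x <= Phi y.
Hypothesis ax10 : axiom10 menus pref.
Let menus0 := [set M | menus M /\ sup_determined menus pref M].

Lemma axiom10_bounded M : menus M -> utility_bounded U M.
Proof.
move=> /ax10[l Ml] s; exists (u l) => _ [f Mf <-].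
exact/UP/Ml.
Qed.

Lemma dominated_menu0 M k : menus M -> M k -> dominates k M -> menus0 M.
Proof.
move=> mM Mk kM; split=> //; apply: attained_sup_determined => // s.
by exists k => // g Mg; apply/UP/kM.
Qed.

Lemma menu0_pref M f g : menus0 M -> M f -> M g ->
  pref M f g <-> Phi (state_regret U M f) <= Phi (state_regret U M g).
Proof.
move=> [mM detM] Mf Mg; have bM := axiom10_bounded mM.
have [lbar Ml] := ax10 mM.
(* The outcome of f lies below the supremum and [lbar] above it, so a mixture of the two attains it.
   The resulting k need not belong to M; adjoining it is harmless because M is determined by its
   suprema. *)
have /choice[k kE] s : exists l, u l = sup (menu_utilities U M s).
  apply: (@utility_between _ _ _ (f s) lbar); rewrite le_sup_utility//=.
  by apply: sup_utility_le => [|h Mh]; [exists f|apply/UP/Ml].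
have dk : dominates k (M `|` [set k]).
  by move=> h s [Mh|->//]; rewrite kE le_sup_utility.
rewrite (detM [set k] (menu1 k) _ f g Mf Mg); last first.
  move=> _ -> s l Msl; apply/UP; rewrite kE.
  by apply: sup_utility_le => [|h Mh]; [exists f|apply/UP/Msl].
rewrite -PhiP; [|exact: regret_ge0..].
apply: (pref_regret_pref ltr01 _ _ _ _ dk) => [||||s|s].
- by apply: menuU.
- by right.
- by left.
- by left.
- by rewrite mul1r kE.
- by rewrite mul1r kE.
Qed.

Lemma represents_max_weighted_set :
  represents U menus0 pref (max_weighted_set Phi).
Proof.
move=> M mM; have bM := axiom10_bounded mM.1; split=> // f g Mf Mg.
rewrite menu0_pref// mwerE !max_weighted_supE//; exact: regret_ge0.
Qed.

(** x is indifferent to the constant [Phi x], and the functional of P fixes constants. A menu of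
    loss acts witnesses this; being dominated, it belongs to [menus0]. *)
Lemma represents_weighted_sup P : weighted_set P -> represents U menus0 pref P ->
  forall x, nonneg x -> weighted_sup P x = Phi x.
Proof.
move=> wP rep x x0; have rP := weighted_sup_functional wP.
have c0 := rf_ge0 rPhi x0; set c := Phi x in c0 *.
have cst0 : nonneg (fun _ : S => c) by [].
have [e e0 [bx bc _]] := loss_box x0 cst0 x0.
have [M [mM M0 dM [Mx Mc _]]] := loss_menu3 bx bc bx.
have ux s := utility_loss_act s bx; have uc s := utility_loss_act s bc.
have [bM prefE] := rep M (dominated_menu0 mM M0 dM).
have supM s : sup (menu_utilities U M s) = 0.
  rewrite -[RHS]oppr0 -(utility_loss_act s box0); apply/eqP; rewrite eq_le.
  rewrite le_sup_utility// andbT; apply: sup_utility_le => [|h /dM//].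
  by exists (loss_act (fun=> 0)).
have regx s : state_regret U M (loss_act (fun s => e * x s)) s = e * x s.
  by rewrite /state_regret supM ux sub0r opprK.
have regc s : state_regret U M (loss_act (fun s => e * c)) s = e * c.
  by rewrite /state_regret supM uc sub0r opprK.
have Px := rf_scale rP (ltW e0) x0 regx; have Pc := rf_scale rP (ltW e0) cst0 regc.
have Phic : Phi (fun=> c) = Phi x by rewrite (rf_cst rPhi).
rewrite -[RHS](rf_cst rP c0); apply/eqP; rewrite eq_le.
rewrite -(ler_pM2l e0) -Px -Pc -[X in _ && X](ler_pM2l e0) -Px -Pc.
apply/andP; split.
  apply/(prefE _ _ Mx Mc)/(pref_loss e0 mM M0 dM Mx Mc ux uc).
  by apply/PhiP; rewrite // Phic.
apply/(prefE _ _ Mc Mx)/(pref_loss e0 mM M0 dM Mc Mx uc ux).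
by apply/PhiP; rewrite // Phic.
Qed.

(** The better of two constant acts dominates the pair, so their menu is in [menus0], where MWER
    orders constants by utility. *)
Lemma represents_same_order U' P : weighted_set P -> represents U' menus0 pref P ->
  forall l l', u l' <= u l <-> utility U' l' <= utility U' l.
Proof.
move=> wP rep l l'; rewrite -UP; pose M : set act := [set const_act l; const_act l'].
have mM : menus M by apply: menuU.
have Ml : M (const_act l) by left.
have Ml' : M (const_act l') by right.
have mM0 : menus0 M.
  have [ll'|l'l] := leP (u l) (u l').
    by apply: (dominated_menu0 mM Ml') => h s [->|->]; rewrite /const_act.
  by apply: (dominated_menu0 mM Ml) => h s [->|->]; [|exact: ltW l'l].
have [bM prefE] := rep M mM0.
by rewrite -(mwer_const wP bM Ml Ml') -prefE.
Qed.

End Representation.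

End Reduction.
End Family.

Theorem theorem1 (R : realType) (S : finType) (Y : choiceType) :
  (forall (U : Y -> R) (P : set (lottery R S * R)),
    (exists y y', U y != U y') -> weighted_set P ->
    [/\ menu_system (@utility_bounded R S Y U),
        axioms1_9 (@utility_bounded R S Y U) (mwer U P),
        menu_system (@lottery_bounded R S Y U),
        axioms1_9 (@lottery_bounded R S Y U) (mwer U P)
      & axiom10 (@lottery_bounded R S Y U) (mwer U P)]) /\
  (forall (menus : set (set (act R S Y)))
          (pref : set (act R S Y) -> act R S Y -> act R S Y -> Prop),
    menu_system menus -> axioms1_9 menus pref -> axiom10 menus pref ->
    let menus0 := [set M | menus M /\ sup_determined menus pref M] in
    exists (P : set (lottery R S * R)) (U : Y -> R),
    [/\ weighted_set P,
        represents U menus0 pref P,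
        forall U' : Y -> R,
          (exists P', weighted_set P' /\ represents U' menus0 pref P') <->
          (exists a b : R, 0 < a /\ forall y, U' y = a * U y + b)
      & forall P', weighted_set P' -> represents U menus0 pref P' ->
          forall Pr alpha, P' (Pr, alpha) ->
          exists alpha', alpha <= alpha' /\ P (Pr, alpha')]).
Proof.
split=> [U P Uyy' wP|menus pref mmenus ax ax10 menus0].
  (* A probability measure has total mass 1, so S cannot be empty. *)
  have [s0 _] : exists s0 : S, True.
    case: (wP) => _ _ [p _]; apply: contrapT => noS.
    have := lottery_fin_sum p; rewrite big1 => [/eqP|s _].
      by rewrite eq_sym oner_eq0.
    by case: noS; exists s.
  have mU := @utility_bounded_menu_system R S Y U.
  have mL := @lottery_bounded_menu_system R S Y U s0.
  split=> //.
  - exact: mwer_axioms1_9.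
  - exact: mwer_axioms1_9 (@lottery_bounded_utility R S Y U) _.
  - move=> M [l Ml]; exists l => f s Mf.
    exact/(const_pref_mwer wP mL (@lottery_bounded_utility R S Y U))/Ml.
have [U [a [b [UP Ua Ub]]]] := utility_exists mmenus ax.
have [Phi rPhi PhiP] :=
  regret_order_functional (regret_pref_order mmenus ax UP Ua Ub).
have wP := max_weighted_setP rPhi.
have rep := represents_max_weighted_set mmenus ax UP Ua Ub rPhi PhiP ax10.
exists (max_weighted_set Phi), U; split=> // [U'|P' wP' rep'].
  split=> [[P' [wP' rep']]|[c [d [c0 U'E]]]].
    exact: same_order_affine (represents_same_order mmenus ax UP wP' rep') Ua Ub.
  by exists (max_weighted_set Phi); split=> //; exact: represents_affine c0 U'E wP rep.
apply: max_weighted_set_max => // x x0.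
exact: (represents_weighted_sup mmenus ax UP Ua Ub rPhi PhiP wP' rep').
Qed.
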